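(* Fix a finite set $\Sigma$ with $|\Sigma|\geq 2$. Every hereditary (ordered) matrix property over $\Sigma$ is strongly testable.
   Context: A matrix over $\Sigma$ is a function $M:[m]\times[n]\to\Sigma$ (row and column orders are kept). For $A=\{a_1<\dots<a_k\}\subseteq[m]$ and $B=\{b_1<\dots<b_l\}\subseteq[n]$, the ordered submatrix of $M$ on $A\times B$ is $N:[k]\times[l]\to\Sigma$ with $N(i,j)=M(a_i,b_j)$. A matrix property is a collection of such matrices; it is hereditary if it is closed under taking ordered submatrices. $M$ is $\epsilon$-far from a property $\mathcal{P}$ if one must change at least $\epsilon mn$ entries of $M$ to obtain a matrix in $\mathcal{P}$. A tester gets $\epsilon>0$ and query access to the entries of $M$; it has one-sided error if it always accepts matrices in $\mathcal{P}$ and rejects matrices $\epsilon$-far from $\mathcal{P}$ with probability at least $2/3$. $\mathcal{P}$ is strongly testable if it has a one-sided error tester whose number of queries is bounded by a function $Q(\mathcal{P},\epsilon)$ independent of the input size. *)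

(* Defs.v *)
From mathcomp Require Import all_boot all_order all_algebra.
From mathcomp Require Import reals.

Set Implicit Arguments.
Unset Strict Implicit.
Unset Printing Implicit Defensive.

Import Order.TTheory GRing.Theory Num.Theory.
Local Open Scope ring_scope.

(* Matrices have at least one row and one column, hence the successors. An
   empty matrix could otherwise both have a property and be eps-far from it,
   as eps * 0 entries must be changed. *)
Definition mxproperty (Sigma : finType) : Type :=
  forall m n : nat, 'M[Sigma]_(m.+1, n.+1) -> Prop.

(* The subset A = {a_1 < ... < a_k} is given by its enumeration i |-> a_i. *)
Definition hereditary (Sigma : finType) (P : mxproperty Sigma) : Prop :=
  forall (m n k l : nat) (M : 'M[Sigma]_(m.+1, n.+1))
         (a : 'I_k.+1 -> 'I_m.+1) (b : 'I_l.+1 -> 'I_n.+1),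
    {homo a : i j / (i < j)%N} -> {homo b : i j / (i < j)%N} ->
    P m n M -> P k l (mxsub a b M).

Definition hamming (Sigma : finType) (m n : nat) (M N : 'M[Sigma]_(m, n)) : nat :=
  #|[set p : 'I_m * 'I_n | M p.1 p.2 != N p.1 p.2]|.

(* If no matrix with the dimensions of M has the property, then M is eps-far
   from it for every eps. *)
Definition far (R : realType) (Sigma : finType) (P : mxproperty Sigma) (eps : R)
    (m n : nat) (M : 'M[Sigma]_(m.+1, n.+1)) : Prop :=
  forall N : 'M[Sigma]_(m.+1, n.+1),
    P m n N -> eps * m.+1%:R * n.+1%:R <= (hamming M N)%:R.

(* Randomized adaptive query algorithms on m x n matrices, as computation
   trees: [Answer true] accepts, [Query i j f] reads the entry (i, j) and
   continues with f applied to its value, and [Draw k f] continues with f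
   applied to a fresh uniform element of 'I_k.+1. *)
Inductive algorithm (Sigma : finType) (m n : nat) : Type :=
| Answer of bool
| Query of 'I_m & 'I_n & (Sigma -> algorithm Sigma m n)
| Draw (k : nat) of ('I_k.+1 -> algorithm Sigma m n).

Fixpoint prob_answer (R : realType) (Sigma : finType) (m n : nat)
    (M : 'M[Sigma]_(m, n)) (b : bool) (t : algorithm Sigma m n) : R :=
  match t with
  | Answer c => (c == b)%:R
  | Query i j f => prob_answer R M b (f (M i j))
  | Draw k f => (\sum_(s < k.+1) prob_answer R M b (f s)) / k.+1%:R
  end.

(* Worst case over the random draws and the answers to the queries. *)
Fixpoint num_queries (Sigma : finType) (m n : nat) (t : algorithm Sigma m n) : nat :=
  match t with
  | Answer _ => 0%N
  | Query _ _ f => (\max_(c : Sigma) num_queries (f c))%N.+1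
  | Draw k f => (\max_(s < k.+1) num_queries (f s))%N
  end.

(* The algorithm may depend on eps and on the dimensions of the input, but sees
   its entries only through queries; its running time is not restricted. *)
Definition tester (R : realType) (Sigma : finType) : Type :=
  R -> forall m n : nat, algorithm Sigma m.+1 n.+1.

Definition one_sided_tester (R : realType) (Sigma : finType)
    (P : mxproperty Sigma) (T : tester R Sigma) : Prop :=
  forall (eps : R) (m n : nat) (M : 'M[Sigma]_(m.+1, n.+1)), 0 < eps ->
    (P m n M -> prob_answer R M true (T eps m n) = 1) /\
    (far P eps M -> 2%:R / 3%:R <= prob_answer R M false (T eps m n)).

Definition strongly_testable (R : realType) (Sigma : finType)
    (P : mxproperty Sigma) : Prop :=
  exists (T : tester R Sigma) (Q : R -> nat),
    one_sided_tester P T /\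
    forall (eps : R) (m n : nat), 0 < eps -> (num_queries (T eps m n) <= Q eps)%N.

(* Main.v *)
(** Accept iff no sampled ordered submatrix violates the property; what must be
    shown is that an eps-far matrix contains a constant proportion of violating
    p x q submatrices, p and q bounded in terms of eps.

    Rows and columns are sorted into finitely many types by a strong regularity
    lemma: the density g of each colour depends on the two types only, is close
    in L1 to a finer density W, and W is close to the matrix in cut norm, with an
    error that is tiny compared with the number of types.  The order is handled
    by intervals: rows are cut into u blocks, and each block into c sub-blocks
    in most of which the types are distributed as in the block (an energy
    argument provides such u and c).  Pick one random j < c and, in the j-th
    sub-block of each block, one random row of each type; do the same for
    columns.  Allow a colour between two (block, type) cells iff W is at least
    gamma at their representatives.  On average few entries of the matrix have a
    forbidden colour, so for some model C of allowed colours, hit with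
    probability at least p0, recolouring those entries gives a matrix that is
    close, hence not in the property, and fits C.  As there are finitely many
    models, C is also fitted by a violating pattern of bounded size.

    Take independent copies of the representatives.  By convexity all pairs of
    copies realise C with probability at least p0^(pq); the copies have distinct
    indices j, and can be sorted by them.  Since copies with larger j lie further
    right in every block, the rows and columns of the pattern can be placed in
    order, each using a copy of its own, so that W >= gamma wherever needed.  The
    counting lemma replaces W by the matrix.

    A dimension that is bounded needs no types: every line is its own block and
    is used at most once. *)

Require Import Defs.
From mathcomp Require Import all_boot all_order all_algebra.
From mathcomp Require Import all_fingroup reals.
From mathcomp Require Import boolp.
From mathcomp Require Import ring lra zify.

Set Implicit Arguments.
Unset Strict Implicit.
Unset Printing Implicit Defensive.

Import Order.TTheory GRing.Theory Num.Theory.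
Local Open Scope ring_scope.

(** * Conditional expectations given a partition *)

Section ConditionalAverage.
Variables (R : realType) (Om : finType).

Definition cavg (L : eqType) (pi : Om -> L) (f : Om -> R) (w : Om) : R :=
  (\sum_(v | pi v == pi w) f v) / (\sum_(v | pi v == pi w) 1).

(** The second labelling is the finer one. *)
Definition refines (T : Type) (L L' : eqType) (pi : T -> L) (pi' : T -> L') :=
  forall v w, pi' v = pi' w -> pi v = pi w.

Variables (L : eqType) (pi : Om -> L).

Lemma fiber_gt0 (w : Om) : 0 < \sum_(v | pi v == pi w) (1 : R).
Proof. by rewrite (bigD1 w) //= ltr_pwDl // sumr_ge0. Qed.

Lemma cavg_eq (f : Om -> R) v w : pi v = pi w -> cavg pi f v = cavg pi f w.
Proof. by rewrite /cavg => ->. Qed.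

Lemma cavg_ge0 (f : Om -> R) w : (forall v, 0 <= f v) -> 0 <= cavg pi f w.
Proof. by move=> f0; rewrite divr_ge0 ?sumr_ge0. Qed.

Lemma cavg_sum (I : finType) (f : I -> Om -> R) w :
  \sum_i cavg pi (f i) w = cavg pi (fun v => \sum_i f i v) w.
Proof. by rewrite /cavg -mulr_suml; congr (_ / _); rewrite exchange_big. Qed.

Lemma cavg_cst1 w : cavg pi (fun=> 1) w = 1.
Proof. by rewrite /cavg divff // gt_eqF ?fiber_gt0. Qed.

(** Averaging is an orthogonal projection onto the functions constant on the fibres: each fibre
    contributes its sum of [f] times the common value of [phi]. *)
Lemma cavg_orth (f phi : Om -> R) :
  (forall v w, pi v = pi w -> phi v = phi w) ->
  \sum_w cavg pi f w * phi w = \sum_w f w * phi w.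
Proof.
move=> phiP.
pose N w : R := \sum_(v | pi v == pi w) 1.
transitivity (\sum_w \sum_(v | pi v == pi w) f v * phi v / N v).
  apply: eq_bigr => w _; rewrite /cavg !mulr_suml; apply: eq_bigr => v /eqP e.
  by rewrite (phiP v w e) /N e mulrAC.
rewrite (exchange_big_dep xpredT) //=; apply: eq_bigr => v _.
rewrite (eq_bigr (fun=> f v * phi v / N v * 1)); last by move=> *; rewrite mulr1.
rewrite -mulr_sumr (eq_bigl (fun w => pi w == pi v)); last by move=> w; rewrite eq_sym.
by rewrite mulfVK // gt_eqF ?fiber_gt0.
Qed.

End ConditionalAverage.

(** The coarse average is also the projection of the fine one, so the mixed term equals the coarse
    square. *)
Lemma cavg_pythagoras (R : realType) (Om : finType) (L L' : eqType)
    (pi : Om -> L) (pi' : Om -> L') (f : Om -> R) :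
  refines pi pi' ->
  \sum_w (cavg pi' f w - cavg pi f w) ^+ 2 =
  \sum_w cavg pi' f w ^+ 2 - \sum_w cavg pi f w ^+ 2.
Proof.
move=> ref.
have mixed : \sum_w cavg pi' f w * cavg pi f w = \sum_w cavg pi f w ^+ 2.
  rewrite cavg_orth; last by move=> v w e; apply: cavg_eq; exact: ref.
  by rewrite -(cavg_orth (pi := pi)) //; exact: cavg_eq.
have -> : \sum_w (cavg pi' f w - cavg pi f w) ^+ 2 =
  \sum_w cavg pi' f w ^+ 2 + \sum_w cavg pi f w ^+ 2
    - (\sum_w cavg pi' f w * cavg pi f w) *+ 2.
  by rewrite -sumrMnl -big_split /= -sumrB; apply: eq_bigr => w _; ring.
by rewrite mixed; ring.
Qed.

(** * Energy increments and the regularity lemmas *)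

Section Regularity.
Variables (R : realType) (Sigma X Y : finType) (M : X -> Y -> Sigma).

Definition ind (s : Sigma) (w : X * Y) : R := (M w.1 w.2 == s)%:R.

Definition lab (tX : X -> nat) (tY : Y -> nat) (w : X * Y) : nat * nat :=
  (tX w.1, tY w.2).

Definition dens tX tY s : X * Y -> R := cavg (lab tX tY) (ind s).

(** The index of a pair of partitions, not divided by [#|X| * #|Y|]. *)
Definition energy tX tY : R := \sum_s \sum_w dens tX tY s w ^+ 2.

Definition cut_close (th : R) (W : Sigma -> X * Y -> R) : Prop :=
  forall s (U : {set X}) (V : {set Y}),
    `|\sum_(w in setX U V) (ind s w - W s w)| <= th * #|X|%:R * #|Y|%:R.

Lemma ind_ge0 s w : 0 <= ind s w. Proof. exact: ler0n. Qed.

Lemma ind_sum w : \sum_s ind s w = 1.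
Proof.
rewrite (bigD1 (M w.1 w.2)) //= /ind eqxx big1 ?addr0 // => s /negPf.
by rewrite eq_sym => ->.
Qed.

Lemma dens_ge0 tX tY s w : 0 <= dens tX tY s w.
Proof. by apply: cavg_ge0 => v; exact: ind_ge0. Qed.

Lemma dens_sum tX tY w : \sum_s dens tX tY s w = 1.
Proof.
rewrite /dens cavg_sum -[RHS](@cavg_cst1 R _ _ (lab tX tY) w) /cavg.
by congr (_ / _); apply: eq_bigr => v _; rewrite ind_sum.
Qed.

Lemma dens_le1 tX tY s w : dens tX tY s w <= 1.
Proof.
rewrite -(dens_sum tX tY w) (bigD1 s) //= lerDl sumr_ge0 // => *.
exact: dens_ge0.
Qed.

Lemma energy_ge0 tX tY : 0 <= energy tX tY.
Proof. by rewrite !sumr_ge0 // => s _; rewrite sumr_ge0 // => w _; exact: sqr_ge0. Qed.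

Lemma sum_cst1 : \sum_(w : X * Y) (1 : R) = #|X|%:R * #|Y|%:R.
Proof. by rewrite sumr_const -natrM card_prod. Qed.

Lemma energy_le tX tY : energy tX tY <= #|X|%:R * #|Y|%:R.
Proof.
rewrite /energy exchange_big -sum_cst1; apply: ler_sum => w _.
rewrite -(dens_sum tX tY w); apply: ler_sum => s _.
by rewrite expr2 ler_piMr ?dens_ge0 ?dens_le1.
Qed.

Lemma refines_lab tX tY tX' tY' :
  refines tX tX' -> refines tY tY' -> refines (lab tX tY) (lab tX' tY').
Proof. by move=> rX rY [x y] [x' y'] [/rX e /rY e']; rewrite /lab /= e e'. Qed.

Lemma energy_diff tX tY tX' tY' :
  refines tX tX' -> refines tY tY' ->
  \sum_s \sum_w (dens tX' tY' s w - dens tX tY s w) ^+ 2 =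
  energy tX' tY' - energy tX tY.
Proof.
move=> rX rY; rewrite /energy -sumrB; apply: eq_bigr => s _.
exact/cavg_pythagoras/refines_lab.
Qed.

(** Doubling keeps the labels in [nat], with a bound [t] becoming [2 t]. *)
Definition split_lab (T : finType) (t : T -> nat) (U : {set T}) (x : T) : nat :=
  (t x).*2 + (x \in U).

Lemma split_lab_refines (T : finType) (t : T -> nat) (U : {set T}) :
  refines t (split_lab t U).
Proof. by move=> x y; rewrite /split_lab; case: (x \in U); case: (y \in U); lia. Qed.

Lemma split_lab_set (T : finType) (t : T -> nat) (U : {set T}) x y :
  split_lab t U x = split_lab t U y -> (x \in U) = (y \in U).
Proof. by rewrite /split_lab; case: (x \in U); case: (y \in U) => //; lia. Qed.

(** The change [d] of the densities correlates with the indicator of the rectangle as much as the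
    discrepancy says, so its square norm is large; by orthogonality this norm is the gain in
    energy. *)
Lemma energy_increment (th : R) tX tY s (U : {set X}) (V : {set Y}) : 0 < th ->
  th * #|X|%:R * #|Y|%:R < `|\sum_(w in setX U V) (ind s w - dens tX tY s w)| ->
  energy tX tY + th ^+ 2 * #|X|%:R * #|Y|%:R
    <= energy (split_lab tX U) (split_lab tY V).
Proof.
move=> th0 big; rewrite -lerBrDl.
have rX := @split_lab_refines _ tX U; have rY := @split_lab_refines _ tY V.
rewrite -energy_diff // (bigD1 s) //=.
set tX' := split_lab tX U; set tY' := split_lab tY V.
pose d w := dens tX' tY' s w - dens tX tY s w.
pose b (w : X * Y) : R := (w \in setX U V)%:R.
(* The indicator [b] is constant on the cells of the split labels, so [ind s] may be replaced by its
   new average. *)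
have sumE : \sum_(w in setX U V) (ind s w - dens tX tY s w) = \sum_w d w * b w.
  under [RHS]eq_bigr do rewrite /d mulrBl /dens.
  rewrite [RHS]sumrB cavg_orth; last first.
    move=> [x y] [x' y'] [/split_lab_set e /split_lab_set e'].
    by rewrite /b !inE /= e e'.
  by rewrite -[RHS]sumrB big_mkcond; apply: eq_bigr => w _; rewrite /b /dens; case: (w \in _) => /=; ring.
rewrite sumE in big.
have others : 0 <= \sum_(i | i != s) \sum_w (dens tX' tY' i w - dens tX tY i w) ^+ 2.
  by rewrite !sumr_ge0 // => i _; rewrite sumr_ge0 // => w _; exact: sqr_ge0.
suff : th ^+ 2 * #|X|%:R * #|Y|%:R <= \sum_w d w ^+ 2 by move: others; rewrite /d; lra.
set S := \sum_w d w * b w in big *.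
pose e : R := Num.sg S.
have e1 : e ^+ 2 <= 1 by rewrite /e; case: sgrP => _; rewrite ?expr0n ?sqrrN ?expr1n //=.
have eS : e * S = `|S| by rewrite /e normrEsg.
(* The square of [d - th e b] is nonnegative. *)
have : \sum_w (d w) ^+ 2 >= \sum_w (2 * th * e * (d w * b w) - th ^+ 2).
  apply: ler_sum => w _.
  have : 0 <= (d w - th * e * b w) ^+ 2 by exact: sqr_ge0.
  have : th ^+ 2 * (e ^+ 2 * b w ^+ 2) <= th ^+ 2.
    rewrite ler_piMr ?sqr_ge0 // mulr_ile1 ?sqr_ge0 //.
    by rewrite /b; case: (_ \in _); rewrite ?expr0n ?expr1n.
  by nra.
rewrite sumrB -mulr_sumr -/S (_ : \sum_w th ^+ 2 = th ^+ 2 * (#|X|%:R * #|Y|%:R)); last first.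
  by rewrite -sum_cst1 mulr_sumr; apply: eq_bigr => *; rewrite mulr1.
rewrite (_ : 2 * th * e * S = 2 * th * `|S|); last by rewrite -eS; ring.
move=> h; apply: le_trans h.
have : th * (th * #|X|%:R * #|Y|%:R) <= th * `|S| by rewrite ler_pM2l // ltW.
by nra.
Qed.

End Regularity.

Definition label_pair (X Y : Type) (tX : X -> nat) (tY : Y -> nat) (t : nat) : Prop :=
  (forall x, tX x < t)%N /\ (forall y, tY y < t)%N.

(* Every violating rectangle raises the energy, which lies in [0, |X| |Y|], by
   a fixed proportion, so few splits suffice. *)
Lemma weak_regularity (R : realType) (th : R) : 0 < th ->
  exists B : nat, forall (Sigma X Y : finType) (M : X -> Y -> Sigma) (t : nat) tX tY,
    label_pair tX tY t ->
    exists tX' tY', [/\ label_pair tX' tY' (t * B), refines tX tX', refines tY tY'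
      & cut_close M th (dens R M tX' tY')].
Proof.
move=> th0.
(* [K] counts the splits that the remaining energy still allows; each split doubles the bound on the
   labels. *)
have step K : forall (Sigma X Y : finType) (M : X -> Y -> Sigma) (t : nat) tX tY,
    label_pair tX tY t ->
    (1 - K%:R * th ^+ 2) * (#|X|%:R * #|Y|%:R) <= energy R M tX tY ->
    exists tX' tY', [/\ label_pair tX' tY' (t * 2 ^ K), refines tX tX', refines tY tY'
      & cut_close M th (dens R M tX' tY')].
  elim: K => [|K IH] Sigma X Y M t tX tY lt en;
    (have [reg|/asboolPn/existsp_asboolPn [s /asboolPn/existsp_asboolPn [U
       /asboolPn/existsp_asboolPn [V /negP]]]] := pselect (cut_close M th (dens R M tX tY))).
  - by exists tX, tY; split=> //; rewrite expn0 muln1.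
  - rewrite -ltNge => bad; exfalso.
    have inc := energy_increment th0 bad.
    have up := energy_le R M (split_lab tX U) (split_lab tY V).
    (* No energy is left, so another increment is a contradiction once it is strictly positive; if
       [X] or [Y] were empty, the violating sum would be zero. *)
    have bound : 0 < th * #|X|%:R * #|Y|%:R.
      rewrite lt_def; apply/andP; split; last by rewrite !mulr_ge0 ?(ltW th0).
      apply/eqP => z; move: bad; rewrite z.
      rewrite big_pred0 ?normr0 ?ltxx // => -[x y].
      move/eqP: z; rewrite !mulf_eq0 (gt_eqF th0) /= !pnatr_eq0.
      by case/orP=> /eqP z; [have := card0_eq z x|have := card0_eq z y]; rewrite !inE.
    by nra.
  - exists tX, tY; split=> //; case: lt => l1 l2.
    by split=> [x|y]; [move: (l1 x)|move: (l2 y)] => /leq_trans; apply;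
      rewrite leq_pmulr // expn_gt0.
  - rewrite -ltNge => bad.
    have inc := energy_increment th0 bad.
    have [| |tX' [tY' [l r1 r2 reg]]] := IH Sigma X Y M t.*2 (split_lab tX U) (split_lab tY V).
    + case: lt => l1 l2; split=> z; rewrite /split_lab.
        by move: (l1 z); case: (_ \in _); lia.
      by move: (l2 z); case: (_ \in _); lia.
    + apply: le_trans inc; move: en; rewrite -natr1; nra.
    + exists tX', tY'; split=> //.
      * by rewrite expnS mulnA muln2.
      * by move=> x y /r1 /split_lab_refines.
      * by move=> x y /r2 /split_lab_refines.
pose K := Num.bound (th ^- 2).
exists (2 ^ K)%N => Sigma X Y M t tX tY lt; apply: step => //.
apply: le_trans (energy_ge0 _ _ _ _); rewrite mulr_le0_ge0 ?mulr_ge0 //.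
have : th ^- 2 < K%:R by rewrite archi_boundP // invr_ge0 sqr_ge0.
rewrite -(@ltr_pM2r _ (th ^+ 2)) ?exprn_gt0 // mulVf ?gt_eqF ?exprn_gt0 // => ?.
by lra.
Qed.

(** Weak regularity is iterated, each time with the accuracy [th t] demanded by the current bound
    [t] on the labels. If the energy gain exceeds [e * #|X| * #|Y|], the fine partition becomes the
    next coarse one, which can happen only about [1 / e] times; otherwise the current coarse and
    fine partitions are as required. *)
Lemma strong_regularity (R : realType) (e : R) (th : nat -> R) :
  0 < e -> (forall t, 0 < th t) ->
  exists T : nat, forall (Sigma X Y : finType) (M : X -> Y -> Sigma),
  exists t tX tY tX' tY', [/\ (t <= T)%N, label_pair tX tY t,
    refines tX tX' /\ refines tY tY',
    cut_close M (th t) (dens R M tX' tY')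
    & energy R M tX' tY' - energy R M tX tY <= e * #|X|%:R * #|Y|%:R].
Proof.
move=> e0 th0.
have step K : forall t0, exists T : nat,
    forall (Sigma X Y : finType) (M : X -> Y -> Sigma) tX0 tY0,
    label_pair tX0 tY0 t0 ->
    (1 - K%:R * e) * (#|X|%:R * #|Y|%:R) <= energy R M tX0 tY0 ->
    exists t tX tY tX' tY', [/\ (t <= T)%N, label_pair tX tY t,
      refines tX tX' /\ refines tY tY',
      cut_close M (th t) (dens R M tX' tY')
      & energy R M tX' tY' - energy R M tX tY <= e * #|X|%:R * #|Y|%:R].
  elim: K => [|K IH] t0; have [B HB] := weak_regularity (th0 t0).
    exists t0 => Sigma X Y M tX tY lt en.
    have [tX' [tY' [lt' rX rY reg]]] := HB Sigma X Y M t0 tX tY lt.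
    exists t0, tX, tY, tX', tY'; split=> //.
    have := energy_le R M tX' tY'; move: en; rewrite mul0r subr0 mul1r.
    have : 0 <= e * #|X|%:R * #|Y|%:R by rewrite !mulr_ge0 // ltW.
    by lra.
  have [T HT] := IH (t0 * B)%N.
  exists (maxn t0 T) => Sigma X Y M tX tY lt en.
  have [tX' [tY' [lt' rX rY reg]]] := HB Sigma X Y M t0 tX tY lt.
  case: (lerP (energy R M tX' tY' - energy R M tX tY) (e * #|X|%:R * #|Y|%:R)) => [small|big].
    by exists t0, tX, tY, tX', tY'; rewrite leq_maxl.
  have [|t [uX [uY [uX' [uY' [le_t H1 H2 H3 H4]]]]]] := HT Sigma X Y M tX' tY' lt'.
    by move: en big; rewrite -natr1; lra.
  by exists t, uX, uY, uX', uY'; split=> //; rewrite leq_max le_t orbT.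
pose K := Num.bound e^-1.
have [T HT] := step K 1%N.
exists T => Sigma X Y M; apply: (HT _ _ _ _ (fun=> 0%N) (fun=> 0%N)) => //.
apply: le_trans (energy_ge0 _ _ _ _); rewrite mulr_le0_ge0 ?mulr_ge0 //.
have : e^-1 < K%:R by rewrite archi_boundP // invr_ge0 ltW.
rewrite -(@ltr_pM2r _ e) // mulVf ?gt_eqF // => ?.
by lra.
Qed.

(** * Moment inequalities and tuples of independent copies *)

Definition ascending (p c : nat) (h : 'I_p -> 'I_c) : bool :=
  [forall i : 'I_p, forall j : 'I_p, (i < j)%N ==> (h i < h j)%N].

Lemma ascendingP (p c : nat) (h : 'I_p -> 'I_c) :
  reflect {homo h : i j / (i < j)%N} (ascending h).
Proof.
apply: (iffP forallP) => [H i j|H i]; first by have /forallP /(_ j) /implyP := H i.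
by apply/forallP => j; apply/implyP; exact: H.
Qed.

Section Moments.
Variable R : realType.

(** A convex function lies above its tangent at [a]. *)
Lemma tangent_power (n : nat) (a x : R) : 0 <= a -> 0 <= x ->
  a ^+ n.+1 + n.+1%:R * a ^+ n * (x - a) <= x ^+ n.+1.
Proof.
move=> a0 x0; elim: n => [|n IH]; first by rewrite !expr1 expr0; lra.
have h1 : 0 <= x * (x ^+ n.+1 - (a ^+ n.+1 + n.+1%:R * a ^+ n * (x - a))).
  by rewrite mulr_ge0 // subr_ge0.
have h2 : 0 <= n.+1%:R * a ^+ n * (x - a) ^+ 2.
  by rewrite mulr_ge0 ?sqr_ge0 // mulr_ge0 ?exprn_ge0.
rewrite -subr_ge0.
suff -> : x ^+ n.+2 - (a ^+ n.+2 + n.+2%:R * a ^+ n.+1 * (x - a)) =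
  x * (x ^+ n.+1 - (a ^+ n.+1 + n.+1%:R * a ^+ n * (x - a)))
  + n.+1%:R * a ^+ n * (x - a) ^+ 2 by apply: addr_ge0.
by rewrite -[n.+2%:R]natr1 !exprS; ring.
Qed.

(** The tangent inequality at the mean [a] is averaged; its linear term vanishes. *)
Lemma power_mean (Om : finType) (mu f : Om -> R) (n : nat) :
  (forall w, 0 <= mu w) -> \sum_w mu w = 1 -> (forall w, 0 <= f w) ->
  (\sum_w mu w * f w) ^+ n <= \sum_w mu w * f w ^+ n.
Proof.
move=> mu0 mu1 f0; case: n => [|n].
  by rewrite expr0 -mu1; apply: ler_sum => w _; rewrite expr0 mulr1.
set a := \sum_w mu w * f w.
have a0 : 0 <= a by apply: sumr_ge0 => w _; rewrite mulr_ge0.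
have -> : a ^+ n.+1 = \sum_w mu w * (a ^+ n.+1 + n.+1%:R * a ^+ n * (f w - a)).
  transitivity (a ^+ n.+1 * \sum_w mu w
    + n.+1%:R * a ^+ n * (\sum_w mu w * f w - a * \sum_w mu w)).
    by rewrite mu1 -/a !mulr1 subrr mulr0 addr0.
  rewrite [a * _]mulr_sumr -sumrB !mulr_sumr -big_split /=.
  by apply: eq_bigr => w _; ring.
by apply: ler_sum => w _; rewrite ler_wpM2l // tangent_power.
Qed.

Lemma sum_ffun_prod (I J : finType) (F : I -> J -> R) :
  \sum_(f : {ffun I -> J}) \prod_i F i (f i) = \prod_i \sum_j F i j.
Proof. by rewrite bigA_distr_bigA. Qed.

(* Two applications of the power mean inequality: the density of K_{p,q} in a
   weighted bipartite graph of density d is at least d^(pq). *)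
Lemma biclique_density (Om Up : finType) (mu : Om -> R) (nu : Up -> R)
    (G : Om -> Up -> bool) (p q : nat) (d : R) :
  (forall w, 0 <= mu w) -> \sum_w mu w = 1 ->
  (forall w, 0 <= nu w) -> \sum_w nu w = 1 ->
  0 <= d -> d <= \sum_w \sum_v mu w * nu v * (G w v)%:R ->
  d ^+ (p * q) <= \sum_(w : {ffun 'I_p -> Om}) \sum_(v : {ffun 'I_q -> Up})
    (\prod_i mu (w i)) * (\prod_j nu (v j)) * \prod_i \prod_j (G (w i) (v j))%:R.
Proof.
move=> mu0 mu1 nu0 nu1 d0 dG.
have prod0 (w : {ffun 'I_p -> Om}) : 0 <= \prod_i mu (w i) by rewrite prodr_ge0.
(* For fixed rows the columns are independent, which produces a [q]-th power; in [step2] the roles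
   are exchanged, which produces a [p]-th power. *)
have step1 : \sum_(w : {ffun 'I_p -> Om}) \sum_(v : {ffun 'I_q -> Up})
    (\prod_i mu (w i)) * (\prod_j nu (v j)) * \prod_i \prod_j (G (w i) (v j))%:R
  = \sum_(w : {ffun 'I_p -> Om}) (\prod_i mu (w i)) *
      (\sum_v nu v * \prod_i (G (w i) v)%:R) ^+ q.
  apply: eq_bigr => w _.
  have -> : (\sum_v nu v * \prod_i (G (w i) v)%:R) ^+ q =
      \prod_(j < q) \sum_v nu v * \prod_i (G (w i) v)%:R by rewrite prodr_const card_ord.
  rewrite -sum_ffun_prod mulr_sumr; apply: eq_bigr => v _.
  by rewrite -mulrA big_split /= exchange_big.
have step2 : \sum_(w : {ffun 'I_p -> Om}) (\prod_i mu (w i)) *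
      (\sum_v nu v * \prod_i (G (w i) v)%:R)
  = \sum_v nu v * (\sum_w mu w * (G w v)%:R) ^+ p.
  under eq_bigr do rewrite mulr_sumr.
  rewrite exchange_big; apply: eq_bigr => v _.
  have -> : (\sum_w mu w * (G w v)%:R) ^+ p =
      \prod_(j < p) \sum_w mu w * (G w v)%:R by rewrite prodr_const card_ord.
  rewrite -sum_ffun_prod mulr_sumr; apply: eq_bigr => w _.
  by rewrite big_split /=; ring.
rewrite step1.
have prodmu1 : \sum_(w : {ffun 'I_p -> Om}) \prod_i mu (w i) = 1.
  by rewrite (sum_ffun_prod (fun=> mu)) mu1 big1.
apply: le_trans (power_mean _ prod0 prodmu1 _); last first.
  by move=> w; rewrite sumr_ge0 // => v _; rewrite mulr_ge0 ?prodr_ge0.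
rewrite step2 exprM lerXn2r ?nnegrE ?exprn_ge0 //.
  by rewrite sumr_ge0 // => v _; rewrite mulr_ge0 // exprn_ge0 // sumr_ge0 // => w _; rewrite mulr_ge0.
apply: le_trans (power_mean _ nu0 nu1 _); last first.
  by move=> v; rewrite sumr_ge0 // => w _; rewrite mulr_ge0.
have dG' : d <= \sum_v nu v * (\sum_w mu w * (G w v)%:R).
  apply: le_trans dG _; rewrite exchange_big le_eqVlt; apply/orP; left; apply/eqP.
  by apply: eq_bigr => v _; rewrite mulr_sumr; apply: eq_bigr => w _; ring.
by rewrite lerXn2r ?nnegrE // (le_trans d0).
Qed.

(** Union bound over pairs of positions: two independent copies agree under [h] with probability the
    sum of squared masses, at most the largest mass. *)
Lemma collision_bound (Om J : finType) (mu : Om -> R) (h : Om -> J) (k : R) (p : nat) :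
  (forall w, 0 <= mu w) -> \sum_w mu w = 1 ->
  0 <= k -> (forall j, \sum_(w | h w == j) mu w <= k) ->
  \sum_(w : {ffun 'I_p -> Om}) (\prod_i mu (w i)) * (~~ injectiveb (fun i => h (w i)))%:R
    <= (p * p)%:R * k.
Proof.
move=> mu0 mu1 k0 hk.
have pair (i1 i2 : 'I_p) : i1 != i2 ->
  \sum_(w : {ffun 'I_p -> Om}) (\prod_i mu (w i)) * (h (w i1) == h (w i2))%:R <= k.
  move=> ne.
  (* [F j] forces positions [i1] and [i2] to take the value [j] and leaves the others free, so the
     event becomes a sum of products over positions. *)
  pose F j (i : 'I_p) v := mu v * ((i == i1) || (i == i2) ==> (h v == j))%:R.
  have -> : \sum_(w : {ffun 'I_p -> Om}) (\prod_i mu (w i)) * (h (w i1) == h (w i2))%:R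
      = \sum_j \prod_i \sum_v F j i v.
    transitivity (\sum_j \sum_(w : {ffun 'I_p -> Om}) \prod_i F j i (w i)); last first.
      by apply: eq_bigr => j _; rewrite sum_ffun_prod.
    rewrite exchange_big; apply: eq_bigr => w _.
    under [RHS]eq_bigr do rewrite /F big_split /=.
    rewrite -mulr_sumr; congr (_ * _).
    rewrite (bigD1 (h (w i1))) //= [X in _ + X]big1 ?addr0; last first.
      move=> j jne; rewrite (bigD1 i1) //= eqxx /=.
      by rewrite eq_sym (negPf jne) mul0r.
    have [e|ne'] := eqVneq (h (w i1)) (h (w i2)).
      rewrite big1 // => i _; case: eqP => [->|_] /=; first by rewrite eqxx.
      by case: eqP => //= ->; rewrite e eqxx.
    by rewrite (bigD1 i2) //= eqxx orbT /= eq_sym (negPf ne') mul0r.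
  have Fj j : \prod_i \sum_v F j i v <= \sum_(v | h v == j) mu v * k.
    rewrite (bigD1 i1) //= (bigD1 i2) 1?eq_sym //= mulrA -[leRHS]mulr1.
    have E (i : 'I_p) : (i == i1) || (i == i2) -> \sum_v F j i v = \sum_(v | h v == j) mu v.
      move=> e; rewrite /F e /= [RHS]big_mkcond /=; apply: eq_bigr => v _.
      by case: eqP => _; rewrite ?mulr1 ?mulr0.
    rewrite !E ?eqxx ?orbT //.
    apply: ler_pM.
    - by rewrite mulr_ge0 ?sumr_ge0.
    - by rewrite prodr_ge0 // => i _; rewrite sumr_ge0 // => v _; rewrite mulr_ge0.
    - by rewrite -mulr_suml ler_wpM2l ?sumr_ge0.
    - rewrite prodr_ile1 // => i _; apply/andP; split.
        by rewrite sumr_ge0 // => v _; rewrite mulr_ge0.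
      by rewrite -mu1; apply: ler_sum => v _; rewrite ler_piMr // lern1 leq_b1.
  apply: le_trans (ler_sum _ (fun j _ => Fj j)) _.
  under eq_bigr do rewrite -mulr_suml.
  rewrite -mulr_suml -[leRHS]mul1r -mu1 [X in _ <= X * _](partition_big h xpredT) //=.
have inj_or (w : {ffun 'I_p -> Om}) :
  (~~ injectiveb (fun i => h (w i)))%:R <=
    \sum_(i1 < p) \sum_(i2 < p | i1 != i2) (h (w i1) == h (w i2))%:R :> R.
  case: injectiveP => /= [_|ninj]; first by rewrite !sumr_ge0 // => i _; rewrite sumr_ge0.
  have [[i1 i2] /andP [ne e]] : exists ii : 'I_p * 'I_p,
      (ii.1 != ii.2) && (h (w ii.1) == h (w ii.2)).
    apply: contrapT => nex; apply: ninj => i1 i2 e; apply/eqP; apply: contrapT => ne.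
    by apply: nex; exists (i1, i2); rewrite e eqxx andbT; apply/negP.
  rewrite /= in ne e; rewrite (bigD1 i1) //= (bigD1 i2) //= e -addrA lerDl.
  by rewrite addr_ge0 // !sumr_ge0 // => i _; rewrite sumr_ge0.
apply: (@le_trans _ _ (\sum_(w : {ffun 'I_p -> Om}) (\prod_i mu (w i)) *
    \sum_(i1 < p) \sum_(i2 < p | i1 != i2) (h (w i1) == h (w i2))%:R)).
  by apply: ler_sum => w _; rewrite ler_wpM2l ?prodr_ge0.
under eq_bigr do rewrite mulr_sumr.
rewrite exchange_big natrM -mulrA /=.
have -> : p%:R * (p%:R * k) = \sum_(i1 < p) \sum_(i2 < p) k.
  by rewrite !sumr_const !card_ord !mulr_natl.
apply: ler_sum => i1 _.
under eq_bigr do rewrite mulr_sumr.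
rewrite exchange_big /= [leLHS]big_mkcond /=; apply: ler_sum => i2 _.
by case: ifP => [/pair|_].
Qed.

Lemma injective_sorting (c p : nat) (h : 'I_p -> 'I_c) : injective h ->
  exists s : 'S_p, {homo h \o s : i j / (i < j)%N}.
Proof.
move=> inj.
pose r := relpre (fun i : 'I_p => nat_of_ord (h i)) leq.
have : perm_eq (sort r (ord_tuple p)) (ord_tuple p) by rewrite perm_sort.
case/tuple_permP => s es; exists s => i j ij /=.
have srt : sorted r (sort r (ord_tuple p)) by apply: sort_sorted => x y; exact: leq_total.
have nthE (k : 'I_p) : nth i (sort r (ord_tuple p)) k = s k.
  by rewrite es -tnth_nth tnth_mktuple tnth_ord_tuple.
have le : (h (s i) <= h (s j))%N.
  rewrite -!nthE; apply: (sorted_leq_nth (leT := r)) => //.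
  - by move=> x y z; exact: leq_trans.
  - by move=> x; exact: leqnn.
  - by rewrite inE size_sort size_tuple.
  - by rewrite inE size_sort size_tuple.
  - exact: ltnW.
rewrite ltn_neqAle le andbT; apply: contraTneq ij => /ord_inj /inj /perm_inj ->.
by rewrite ltnn.
Qed.

(** Some permutation makes an injective tuple ascending, and [H] does not see the permutation; hence
    the factor [p!]. *)
Lemma sum_over_injective (Om : finType) (c p : nat) (h : Om -> 'I_c)
    (H : {ffun 'I_p -> Om} -> R) :
  (forall w, 0 <= H w) -> (forall (s : 'S_p) (w : {ffun 'I_p -> Om}), H [ffun i => w (s i)] = H w) ->
  \sum_(w : {ffun 'I_p -> Om} | injectiveb (fun i => h (w i))) H w <=
    (p`!)%:R * \sum_(w : {ffun 'I_p -> Om} | ascending (fun i => h (w i))) H w.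
Proof.
move=> H0 Hsym.
pose incr (w : {ffun 'I_p -> Om}) := ascending (fun i => h (w i)).
pose act (s : 'S_p) (w : {ffun 'I_p -> Om}) : {ffun 'I_p -> Om} := [ffun i => w (s i)].
apply: (@le_trans _ _ (\sum_(w : {ffun 'I_p -> Om}) \sum_(s : 'S_p) H w * (incr (act s w))%:R)).
  rewrite big_mkcond; apply: ler_sum => w _.
  case: ifP => [/injectiveP inj|_]; last by rewrite sumr_ge0 // => s _; rewrite mulr_ge0.
  have [s hs] := injective_sorting inj.
  rewrite (bigD1 s) //= (_ : incr _ = true); last first.
    by apply/ascendingP => i j ij; rewrite !ffunE; exact: hs.
  by rewrite mulr1 lerDl sumr_ge0 // => s' _; rewrite mulr_ge0.
rewrite exchange_big /=.
rewrite (_ : (p`!)%:R * _ = \sum_(s : 'S_p) \sum_(w | incr w) H w); last first.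
  by rewrite sumr_const card_Sn mulr_natl.
apply: ler_sum => s _.
rewrite [leRHS]big_mkcond [leRHS](reindex_inj (h := act s)) /=.
  by apply: ler_sum => w _; rewrite Hsym; case: (incr _); rewrite ?mulr1 ?mulr0.
move=> w w' /ffunP e; apply/ffunP => i; have := e ((s^-1)%g i).
by rewrite !ffunE permKV.
Qed.

Lemma sum_pushforward (Om T : finType) (mu : Om -> R) (p : nat)
    (Z : 'I_p -> Om -> T) (z : 'I_p -> T) (k : R) :
  (forall w, 0 <= mu w) -> (forall i, \sum_(w | Z i w == z i) mu w <= k) ->
  \sum_(w : {ffun 'I_p -> Om}) (\prod_i mu (w i)) * [forall i, Z i (w i) == z i]%:R <= k ^+ p.
Proof.
move=> mu0 hk.
rewrite (_ : k ^+ p = \prod_(i < p) k); last by rewrite prodr_const card_ord.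
apply: (@le_trans _ _ (\prod_(i < p) \sum_(w | Z i w == z i) mu w)); last first.
  by apply: ler_prod => i _; rewrite hk sumr_ge0.
rewrite (eq_bigr (fun i => \sum_w mu w * (Z i w == z i)%:R)); last first.
  by move=> i _; rewrite big_mkcond; apply: eq_bigr => w _; case: eqP; rewrite ?mulr1 ?mulr0.
rewrite -sum_ffun_prod; apply: ler_sum => w _; rewrite big_split /=.
rewrite ler_wpM2l ?prodr_ge0 //; case: forallP => [all|_]; last by rewrite prodr_ge0.
by rewrite big1 // => i _; rewrite all.
Qed.

End Moments.

(** * The counting lemma for the cut norm *)

Definition upd (I T : finType) (z : {ffun I -> T}) (i : I) (x : T) : {ffun I -> T} :=
  [ffun k => if k == i then x else z k].

(** The map [(z, x) |-> (upd z i x, z i)] is an involution: a coordinate may be resampled without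
    changing the uniform distribution. *)
Lemma sum_upd (R : realType) (I T : finType) (i : I) (H : {ffun I -> T} -> R) :
  \sum_z \sum_x H (upd z i x) = #|T|%:R * \sum_z H z.
Proof.
rewrite pair_big /= (reindex (fun zx => (upd zx.1 i zx.2, zx.1 i))) /=.
  rewrite -(pair_big xpredT xpredT (fun z x => H (upd (upd z i x) i (z i)))) /=.
  rewrite mulr_sumr; apply: eq_bigr => z _.
  rewrite (eq_bigr (fun=> H z)) ?sumr_const ?mulr_natl // => x _; congr H.
  by apply/ffunP => k; rewrite !ffunE; case: eqP => [->|].
apply: onW_bij; apply: inv_bij => -[z x] /=; congr (_, _); last by rewrite ffunE eqxx.
by apply/ffunP => k; rewrite !ffunE; case: eqP => [->|].
Qed.

Section Counting.
Variables (R : realType) (X Y : finType) (p q : nat).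
Implicit Types (z : {ffun 'I_p -> X}) (v : {ffun 'I_q -> Y}).

Definition unit_valued (T : Type) (f : T -> R) : Prop := forall x, 0 <= f x <= 1.

Lemma linear_extreme (T : finType) (u a : T -> R) : unit_valued u ->
  \sum_x u x * a x <= \sum_(x in [set x | 0 <= a x]) a x.
Proof.
move=> u01; rewrite [leRHS]big_mkcond; apply: ler_sum => x _.
have /andP [u0 u1] := u01 x; rewrite inE; case: (lerP 0 (a x)) => a0; first by rewrite ler_piMl.
by rewrite mulr_ge0_le0 // ltW.
Qed.

(** A bilinear form in weights from the unit interval is largest at 0-1 weights, that is, on a
    rectangle. *)
Lemma bilinear_extreme (u : X -> R) (v : Y -> R) (d : X -> Y -> R) (K : R) :
  unit_valued u -> unit_valued v ->
  (forall (U : {set X}) (V : {set Y}), \sum_(x in U) \sum_(y in V) d x y <= K) ->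
  \sum_x \sum_y u x * v y * d x y <= K.
Proof.
move=> u01 v01 dK.
rewrite (eq_bigr (fun x => u x * \sum_y v y * d x y)); last first.
  by move=> x _; rewrite mulr_sumr; apply: eq_bigr => y _; rewrite mulrA.
apply: le_trans (linear_extreme _ u01) _.
set U := [set _ | _]; rewrite exchange_big /=.
rewrite (eq_bigr (fun y => v y * \sum_(x in U) d x y)); last by move=> y _; rewrite mulr_sumr.
apply: le_trans (linear_extreme _ v01) _.
by rewrite exchange_big; exact: dK.
Qed.

(** With all coordinates but [z i] and [v j] frozen, [G] is a product of a function of each. Against
    such weights a cut-norm bound can be used. *)
Definition rectangular (i : 'I_p) (j : 'I_q)
    (G : {ffun 'I_p -> X} -> {ffun 'I_q -> Y} -> R) : Prop :=
  forall z v, exists (a : X -> R) (b : Y -> R), [/\ unit_valued a, unit_valued b &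
    forall x y, G (upd z i x) (upd v j y) = a x * b y].

Lemma rectangularM i j G G' : rectangular i j G -> rectangular i j G' ->
  rectangular i j (fun z v => G z v * G' z v).
Proof.
move=> rG rG' z v; have [a [b [a01 b01 e]]] := rG z v; have [a' [b' [a01' b01' e']]] := rG' z v.
exists (fun x => a x * a' x), (fun y => b y * b' y); split.
- by move=> x; have /andP [? ?] := a01 x; have /andP [? ?] := a01' x; rewrite mulr_ge0 ?mulr_ile1.
- by move=> x; have /andP [? ?] := b01 x; have /andP [? ?] := b01' x; rewrite mulr_ge0 ?mulr_ile1.
- by move=> x y; rewrite e e' mulrACA.
Qed.

(** An entry other than [(i, j)] involves at most one of the two free coordinates. *)
Lemma rectangular_entry i j i' j' (h : X -> Y -> R) :
  (i', j') != (i, j) -> (forall x y, 0 <= h x y <= 1) ->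
  rectangular i j (fun z v => h (z i') (v j')).
Proof.
move=> ne h01 z v; have [ei|ni] := eqVneq i' i.
  have nj : j' != j by apply: contraNN ne => /eqP ->; rewrite ei.
  exists (fun x => h x (v j')), (fun=> 1); split=> [x|x|x y] //; first by rewrite ler01 lexx.
  by rewrite !ffunE ei eqxx (negPf nj) mulr1.
exists (fun=> 1), (fun y => h (z i') (if j' == j then y else v j')).
split=> [x|x|x y] //; first by rewrite ler01 lexx.
by rewrite !ffunE (negPf ni) mul1r.
Qed.

Variables (f W : 'I_p -> 'I_q -> X -> Y -> R) (th : R).
Hypothesis (f01 : forall i j x y, 0 <= f i j x y <= 1).
Hypothesis (W01 : forall i j x y, 0 <= W i j x y <= 1).
Hypothesis (X0 : (0 < #|X|)%N) (Y0 : (0 < #|Y|)%N).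
Hypothesis cut : forall i j (U : {set X}) (V : {set Y}),
  \sum_(x in U) \sum_(y in V) (W i j x y - f i j x y) <= th * #|X|%:R * #|Y|%:R.

(** Coordinates [i] and [j] are resampled; for each choice of the others [bilinear_extreme]
    applies. *)
Lemma counting_step i j G : rectangular i j G ->
  \sum_z \sum_v G z v * (W i j (z i) (v j) - f i j (z i) (v j))
    <= th * #|X|%:R ^+ p * #|Y|%:R ^+ q.
Proof.
move=> rG; pose H z v := G z v * (W i j (z i) (v j) - f i j (z i) (v j)).
change (\sum_z \sum_v H z v <= th * #|X|%:R ^+ p * #|Y|%:R ^+ q).
have XY : 0 < #|X|%:R * #|Y|%:R :> R by rewrite mulr_gt0 // ltr0n.
rewrite -(ler_pM2l XY).
have -> : #|X|%:R * #|Y|%:R * \sum_z \sum_v H z v =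
    \sum_z \sum_v \sum_x \sum_y H (upd z i x) (upd v j y).
  rewrite -mulrA [#|Y|%:R * _]mulr_sumr -(sum_upd i); apply: eq_bigr => z _.
  rewrite exchange_big; apply: eq_bigr => x _ /=.
  by rewrite -(sum_upd j (fun v => H (upd z i x) v)).
have -> : #|X|%:R * #|Y|%:R * (th * #|X|%:R ^+ p * #|Y|%:R ^+ q) =
    \sum_(z : {ffun 'I_p -> X}) \sum_(v : {ffun 'I_q -> Y}) th * #|X|%:R * #|Y|%:R.
  rewrite (eq_bigr (fun=> #|Y|%:R ^+ q * (th * #|X|%:R * #|Y|%:R))); last first.
    by move=> z _; rewrite sumr_const card_ffun card_ord -[LHS]mulr_natl natrX.
  by rewrite sumr_const card_ffun card_ord -[RHS]mulr_natl natrX; ring.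
apply: ler_sum => z _; apply: ler_sum => v _.
have [a [b [a01 b01 e]]] := rG z v.
under eq_bigr => x _ do under eq_bigr => y _ do rewrite /H e !ffunE !eqxx.
exact: bilinear_extreme.
Qed.

(** Entries are switched from [W] to [f] one at a time. The factors of the other entries, those
    already switched being absorbed into [G], form a rectangular weight for the current one. *)
Lemma counting (s : seq ('I_p * 'I_q)) G : uniq s ->
  (forall e, e \in s -> rectangular e.1 e.2 G) ->
  \sum_z \sum_v G z v * \prod_(e <- s) W e.1 e.2 (z e.1) (v e.2) <=
  \sum_z \sum_v G z v * \prod_(e <- s) f e.1 e.2 (z e.1) (v e.2)
    + (size s)%:R * (th * #|X|%:R ^+ p * #|Y|%:R ^+ q).
Proof.
elim: s G => [|e s IH] G /=.
  move=> _ _; rewrite mul0r addr0.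
  by apply: ler_sum => z _; apply: ler_sum => v _; rewrite !big_nil.
case/andP=> es us rG.
have rs e' : e' \in s -> e' != e by move=> e's; apply: contraNneq es => <-.
have rprod s' : {subset s' <= s} ->
    rectangular e.1 e.2 (fun z v => \prod_(e <- s') W e.1 e.2 (z e.1) (v e.2)).
  elim: s' => [|e' s' IHs] sub.
    move=> z v; exists (fun=> 1), (fun=> 1); split=> [x|x|x y]; rewrite ?ler01 ?lexx //.
    by rewrite big_nil mulr1.
  have re' : rectangular e.1 e.2 (fun z v => W e'.1 e'.2 (z e'.1) (v e'.2)).
    apply: rectangular_entry => //; have := rs e' (sub _ (mem_head _ _)).
    by case: (e') (e) => ? ? [].
  have rs' := IHs (fun x xs => sub x (mem_behead (s := e' :: s') xs)).
  move=> z v; have [a [b [a01 b01 eab]]] := rectangularM re' rs' z v.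
  by exists a, b; split=> // x y; rewrite big_cons eab.
have step := counting_step (rectangularM (rG e (mem_head _ _)) (rprod s (fun x => id))).
have rest : \sum_z \sum_v (G z v * f e.1 e.2 (z e.1) (v e.2)) *
      \prod_(e <- s) W e.1 e.2 (z e.1) (v e.2) <=
    \sum_z \sum_v (G z v * f e.1 e.2 (z e.1) (v e.2)) *
      \prod_(e <- s) f e.1 e.2 (z e.1) (v e.2)
    + (size s)%:R * (th * #|X|%:R ^+ p * #|Y|%:R ^+ q).
  apply: IH us _ => e' e's; apply: rectangularM.
    by apply: rG; rewrite inE e's orbT.
  apply: rectangular_entry => //; rewrite eq_sym; have := rs e' e's.
  by case: (e') (e) => ? ? [].
have -> : \sum_z \sum_v G z v * \prod_(e <- e :: s) W e.1 e.2 (z e.1) (v e.2) =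
   \sum_z \sum_v (G z v * \prod_(e <- s) W e.1 e.2 (z e.1) (v e.2)) *
     (W e.1 e.2 (z e.1) (v e.2) - f e.1 e.2 (z e.1) (v e.2)) +
   \sum_z \sum_v (G z v * f e.1 e.2 (z e.1) (v e.2)) *
      \prod_(e <- s) W e.1 e.2 (z e.1) (v e.2).
  rewrite -big_split; apply: eq_bigr => z _; rewrite -big_split; apply: eq_bigr => v _.
  by rewrite big_cons /=; ring.
have -> : \sum_z \sum_v G z v * \prod_(e <- e :: s) f e.1 e.2 (z e.1) (v e.2) =
   \sum_z \sum_v (G z v * f e.1 e.2 (z e.1) (v e.2)) *
      \prod_(e <- s) f e.1 e.2 (z e.1) (v e.2).
  by apply: eq_bigr => z _; apply: eq_bigr => v _; rewrite big_cons /=; ring.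
by rewrite -natr1 mulrDl mul1r; move: step rest; lra.
Qed.

End Counting.

(** * Random systems of representatives *)

Definition slot_rel (b : bool) (s s' : nat) : bool := if b then (s < s')%N else (s <= s')%N.

(** A random choice of one row for each cell (slot, type). Slots are blocks of rows; with [b] true
    they are compared strictly, so that each is used at most once. [rs_time] is the random index
    [j], and outcomes with increasing times are ordered across all admissible pairs of slots.
    [rs_row_le] bounds the law of each representative by [D] times the uniform law. [rs_near] bounds
    the rise in the average of a type-dependent test function when every row is replaced by the
    representative of its cell. *)
Record rep_system (R : realType) (b : bool) (m u t c : nat) (tau : 'I_m -> 'I_t)
    (D e : R) := RepSystem {
  rs_slot : 'I_m -> 'I_u;
  rs_space : finType;
  rs_mu : rs_space -> R;
  rs_row : rs_space -> 'I_u * 'I_t -> 'I_m;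
  rs_time : rs_space -> 'I_c;
  rs_slot_mono : forall x y : 'I_m, (x < y)%N -> slot_rel b (rs_slot x) (rs_slot y);
  rs_mu_ge0 : forall w, 0 <= rs_mu w;
  rs_mu_sum : \sum_w rs_mu w = 1;
  rs_time_le : forall j, \sum_(w | rs_time w == j) rs_mu w <= c%:R^-1;
  rs_order : forall w w' (a a' : 'I_u * 'I_t), 0 < rs_mu w -> 0 < rs_mu w' -> slot_rel b a.1 a'.1 ->
    (rs_time w < rs_time w')%N -> (rs_row w a < rs_row w' a')%N;
  rs_row_le : forall a z, \sum_(w | rs_row w a == z) rs_mu w <= D / m%:R;
  rs_near : forall psi : 'I_t -> 'I_m -> R, (forall a x, 0 <= psi a x <= 1) ->
    \sum_x \sum_w rs_mu w * psi (tau x) (rs_row w (rs_slot x, tau x))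
      <= \sum_x psi (tau x) x + e * m%:R
}.

Arguments rs_slot {R b m u t c tau D e} r.
Arguments rs_space {R b m u t c tau D e} r.
Arguments rs_mu {R b m u t c tau D e} r.
Arguments rs_row {R b m u t c tau D e} r.
Arguments rs_time {R b m u t c tau D e} r.
Arguments rs_slot_mono {R b m u t c tau D e} r.
Arguments rs_mu_ge0 {R b m u t c tau D e} r.
Arguments rs_mu_sum {R b m u t c tau D e} r.
Arguments rs_time_le {R b m u t c tau D e} r.
Arguments rs_order {R b m u t c tau D e} r.
Arguments rs_row_le {R b m u t c tau D e} r.
Arguments rs_near {R b m u t c tau D e} r.

(** * The random model of allowed colours *)

Section Core.
Variables (R : realType) (Sigma : finType) (b1 b2 : bool) (m n u1 u2 t c1 c2 : nat).
Variables (tau1 : 'I_m -> 'I_t) (tau2 : 'I_n -> 'I_t) (D1 D2 e1 e2 : R).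
Variables (S1 : rep_system b1 u1 c1 tau1 D1 e1) (S2 : rep_system b2 u2 c2 tau2 D2 e2).
Variables (M : 'I_m -> 'I_n -> Sigma) (W : Sigma -> 'I_m * 'I_n -> R) (gam : R).


Definition cells := (('I_u1 * 'I_t) * ('I_u2 * 'I_t))%type.

Definition row_cell (x : 'I_m) : 'I_u1 * 'I_t := (rs_slot S1 x, tau1 x).
Definition col_cell (y : 'I_n) : 'I_u2 * 'I_t := (rs_slot S2 y, tau2 y).

(** The model of allowed colours read off from one choice of row and column representatives. *)
Definition rich (w : rs_space S1) (v : rs_space S2) : {ffun cells -> {set Sigma}} :=
  [ffun c => [set s | gam <= W s (rs_row S1 w c.1, rs_row S2 v c.2)]].

Definition misfits (C : {ffun cells -> {set Sigma}}) : R :=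
  \sum_x \sum_y (M x y \notin C (row_cell x, col_cell y))%:R.

Definition poor_prob s (c : cells) : R :=
  \sum_w \sum_v rs_mu S1 w * rs_mu S2 v * (W s (rs_row S1 w c.1, rs_row S2 v c.2) < gam)%R%:R.

Lemma poor_prob01 s c : 0 <= poor_prob s c <= 1.
Proof.
have mu0 := rs_mu_ge0 S1; have nu0 := rs_mu_ge0 S2.
apply/andP; split; first by rewrite !sumr_ge0 // => w _; rewrite sumr_ge0 // => v _; rewrite !mulr_ge0.
have <- : \sum_w \sum_v rs_mu S1 w * rs_mu S2 v = 1.
  by under eq_bigr do rewrite -mulr_sumr rs_mu_sum mulr1; rewrite rs_mu_sum.
by apply: ler_sum => w _; apply: ler_sum => v _; rewrite ler_piMr ?mulr_ge0 // lern1 leq_b1.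
Qed.

(** The probability is constant on each cell of the grid, and such a cell is a rectangle: the
    cut-norm error is paid once per cell. *)
Lemma cell_errors (th : R) : cut_close M th W -> 0 <= th -> forall s,
  \sum_x \sum_y (ind R M s (x, y) - W s (x, y)) * poor_prob s (row_cell x, col_cell y)
    <= (#|{: cells}|)%:R * (th * m%:R * n%:R).
Proof.
move=> cut th0 s; rewrite pair_big /=.
rewrite (partition_big (fun w : 'I_m * 'I_n => (row_cell w.1, col_cell w.2)) xpredT) //=.
rewrite (_ : _%:R * _ = \sum_(c : cells) th * m%:R * n%:R); last first.
  by rewrite sumr_const mulr_natl.
apply: ler_sum => c _.
rewrite (eq_bigr (fun w => (ind R M s w - W s w) * poor_prob s c)); last first.
  by case=> x y /= /eqP ->.
rewrite -mulr_suml.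
have /andP [p0 p1] := poor_prob01 s c.
pose U := [set x | row_cell x == c.1]; pose V := [set y | col_cell y == c.2].
rewrite (eq_bigl (fun w => w \in setX U V)); last first.
  by case=> x y; rewrite !inE /=; case: (c).
have := cut s U V; rewrite !card_ord => /ler_normlW H.
have Z : 0 <= th * m%:R * n%:R by rewrite !mulr_ge0.
apply: le_trans (ler_wpM2r p0 H) _.
by rewrite ler_piMr.
Qed.

(** Rows are exchanged for their representatives first, with the column representatives held fixed;
    then columns, row by row. Both exchanges use [rs_near], with [g] times the indicator of a small
    [W] as test function. *)
Lemma near_errors (g : 'I_t -> 'I_t -> R) s : (forall a a', 0 <= g a a' <= 1) ->
  \sum_x \sum_y g (tau1 x) (tau2 y) * poor_prob s (row_cell x, col_cell y) <=
  \sum_x \sum_y g (tau1 x) (tau2 y) * (W s (x, y) < gam)%R%:R + (e1 + e2) * m%:R * n%:R.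
Proof.
move=> g01.
have g0 a a' : 0 <= g a a' by case/andP: (g01 a a').
have gb a a' (b : bool) : 0 <= g a a' * b%:R <= 1.
  by case: b; rewrite ?mulr1 // mulr0 lexx ler01.
have rows : \sum_x \sum_y g (tau1 x) (tau2 y) * poor_prob s (row_cell x, col_cell y) <=
   \sum_x \sum_y \sum_v rs_mu S2 v * (g (tau1 x) (tau2 y) *
     (W s (x, rs_row S2 v (col_cell y)) < gam)%R%:R) + e1 * m%:R * n%:R.
  have -> : e1 * m%:R * n%:R = \sum_(y < n) \sum_v rs_mu S2 v * (e1 * m%:R).
    rewrite (eq_bigr (fun=> e1 * m%:R)) ?sumr_const ?card_ord ?mulr_natr // => y _.
    by rewrite -mulr_suml rs_mu_sum mul1r.
  rewrite [X in X + _]exchange_big [leLHS]exchange_big -big_split /=; apply: ler_sum => y _.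
  rewrite [X in X + _]exchange_big -big_split /=.
  have -> : \sum_x g (tau1 x) (tau2 y) * poor_prob s (row_cell x, col_cell y) =
    \sum_v rs_mu S2 v * \sum_x \sum_w rs_mu S1 w *
      (g (tau1 x) (tau2 y) * (W s (rs_row S1 w (row_cell x), rs_row S2 v (col_cell y)) < gam)%R%:R).
    under [RHS]eq_bigr do rewrite mulr_sumr.
    rewrite [RHS]exchange_big; apply: eq_bigr => x _.
    under [RHS]eq_bigr do rewrite mulr_sumr.
    rewrite [RHS]exchange_big /poor_prob mulr_sumr; apply: eq_bigr => w _.
    by rewrite mulr_sumr; apply: eq_bigr => v _ /=; ring.
  apply: ler_sum => v _; rewrite -mulr_sumr -mulrDr ler_wpM2l ?rs_mu_ge0 //.
  exact: (rs_near _ (fun a x => g a (tau2 y) * (W s (x, rs_row S2 v (col_cell y)) < gam)%R%:R)).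
apply: le_trans rows _.
rewrite mulrDl mulrDl [e1 * _ * _ + _]addrC addrA lerD2r.
have -> : e2 * m%:R * n%:R = \sum_(x < m) e2 * n%:R.
  by rewrite sumr_const card_ord -[RHS]mulr_natr; ring.
rewrite -big_split; apply: ler_sum => x _ /=.
exact: (rs_near _ (fun a y => g (tau1 x) a * (W s (x, y) < gam)%R%:R)).
Qed.

(* Replacing [M] by [W], then [W] by the step function [g], then averaging over
   the representatives, each at a small cost. *)
Lemma expected_misfits (th d : R) (g : Sigma -> 'I_t -> 'I_t -> R) :
  cut_close M th W -> 0 <= th -> (forall s a a', 0 <= g s a a' <= 1) -> 0 <= gam ->
  \sum_s \sum_x \sum_y `|W s (x, y) - g s (tau1 x) (tau2 y)| <= d * m%:R * n%:R ->
  \sum_w \sum_v rs_mu S1 w * rs_mu S2 v * misfits (rich w v) <=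
  ((#|Sigma| * #|{: cells}|)%:R * th + (d + d) + #|Sigma|%:R * (e1 + e2 + gam)) * m%:R * n%:R.
Proof.
move=> cut th0 g01 gam0 L1.
have -> : \sum_w \sum_v rs_mu S1 w * rs_mu S2 v * misfits (rich w v) =
    \sum_s \sum_x \sum_y ind R M s (x, y) * poor_prob s (row_cell x, col_cell y).
  transitivity (\sum_x \sum_y poor_prob (M x y) (row_cell x, col_cell y)); last first.
    rewrite [RHS]exchange_big; apply: eq_bigr => x _; rewrite [RHS]exchange_big; apply: eq_bigr => y _ /=.
    rewrite (bigD1 (M x y)) //= /ind eqxx mul1r big1 ?addr0 // => s /negPf.
    by rewrite /= eq_sym => ->; rewrite mul0r.
  transitivity (\sum_w \sum_v \sum_x \sum_y rs_mu S1 w * rs_mu S2 v *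
      (W (M x y) (rs_row S1 w (row_cell x), rs_row S2 v (col_cell y)) < gam)%R%:R).
    apply: eq_bigr => w _; apply: eq_bigr => v _; rewrite /misfits mulr_sumr.
    apply: eq_bigr => x _; rewrite mulr_sumr; apply: eq_bigr => y _.
    by rewrite ffunE inE /= ltNge.
  under eq_bigr do rewrite exchange_big.
  rewrite [LHS]exchange_big; apply: eq_bigr => x _ /=.
  under eq_bigr do rewrite exchange_big.
  by rewrite [LHS]exchange_big.
pose l s := \sum_x \sum_y `|W s (x, y) - g s (tau1 x) (tau2 y)|.
have bound s : \sum_x \sum_y ind R M s (x, y) * poor_prob s (row_cell x, col_cell y) <=
    (#|{: cells}|)%:R * (th * m%:R * n%:R)
    + (l s + l s)
    + (e1 + e2 + gam) * m%:R * n%:R.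
  have A := cell_errors cut th0 s.
  have B := near_errors s (g01 s).
  have C : \sum_x \sum_y (W s (x, y) - g s (tau1 x) (tau2 y)) * poor_prob s (row_cell x, col_cell y)
    <= l s.
    apply: ler_sum => x _; apply: ler_sum => y _.
    have /andP [p0 p1] := poor_prob01 s (row_cell x, col_cell y).
    apply: le_trans (ler_wpM2r p0 (ler_norm _)) _.
    by rewrite ler_piMr.
  have E : \sum_x \sum_y g s (tau1 x) (tau2 y) * (W s (x, y) < gam)%R%:R <=
     l s + gam * m%:R * n%:R.
    have -> : gam * m%:R * n%:R = \sum_(x < m) \sum_(y < n) gam.
      by rewrite !sumr_const !card_ord !mulr_natr mulrnAC.
    rewrite -big_split; apply: ler_sum => x _ /=; rewrite -big_split; apply: ler_sum => y _ /=.
    case: (ltrP (W s (x, y)) gam) => lt; rewrite ?mulr1 ?mulr0.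
      by have := ler_norm (- (W s (x, y) - g s (tau1 x) (tau2 y))); rewrite normrN; lra.
    by rewrite addr_ge0.
  have split3 : \sum_x \sum_y ind R M s (x, y) * poor_prob s (row_cell x, col_cell y) =
    \sum_x \sum_y (ind R M s (x, y) - W s (x, y)) * poor_prob s (row_cell x, col_cell y) +
    \sum_x \sum_y (W s (x, y) - g s (tau1 x) (tau2 y)) * poor_prob s (row_cell x, col_cell y) +
    \sum_x \sum_y g s (tau1 x) (tau2 y) * poor_prob s (row_cell x, col_cell y).
    rewrite -!big_split; apply: eq_bigr => x _ /=; rewrite -!big_split; apply: eq_bigr => y _ /=.
    by ring.
  by rewrite split3; move: A B C E; lra.
apply: le_trans (ler_sum _ (fun s _ => bound s)) _.
rewrite !big_split /= !sumr_const natrM.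
rewrite -[X in X + _ + _]mulr_natl -[X in _ + _ + X]mulr_natl.
have L1' : \sum_s l s <= d * m%:R * n%:R by exact: L1.
by move: L1'; lra.
Qed.

(** * Placing a pattern on independent copies *)

Section Blowup.
Variables (p q : nat) (C : {ffun cells -> {set Sigma}}).
Variables (r : 'I_p -> 'I_u1 * 'I_t) (k : 'I_q -> 'I_u2 * 'I_t).
Hypothesis (r_mono : forall i i' : 'I_p, (i < i')%N -> slot_rel b1 (r i).1 (r i').1).
Hypothesis (k_mono : forall j j' : 'I_q, (j < j')%N -> slot_rel b2 (k j).1 (k j').1).

Definition good_tuple (z : {ffun 'I_p -> 'I_m}) (v : {ffun 'I_q -> 'I_n}) : bool :=
  [&& ascending z, ascending v &
    [forall i, forall j, forall s, (s \in C (r i, k j)) ==> (gam <= W s (z i, v j))]].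

(** Among [p] and [q] independent copies, all pairs realise [C] with probability at least
    [d ^+ (p * q)]; the subtracted terms pay for copies that share a time. Sorting the rest by time
    costs the factorials. The [i]-th copy then supplies the row for the cell [r i], so rows come out
    in order, and the bounded law of the representatives turns probability into a number of
    tuples. *)
Lemma good_tuples (d : R) : 0 <= d ->
  d <= \sum_w \sum_v rs_mu S1 w * rs_mu S2 v * (rich w v == C)%:R ->
  d ^+ (p * q) - (p * p)%:R / c1%:R - (q * q)%:R / c2%:R <=
  (p`! * q`!)%:R * (\sum_z \sum_v (good_tuple z v)%:R) * (D1 / m%:R) ^+ p * (D2 / n%:R) ^+ q.
Proof.
move=> d0 dC.
have mu0 := rs_mu_ge0 S1; have nu0 := rs_mu_ge0 S2.
have mu1 := rs_mu_sum S1; have nu1 := rs_mu_sum S2.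
pose mup (w : {ffun 'I_p -> rs_space S1}) := \prod_i rs_mu S1 (w i).
pose nuq (v : {ffun 'I_q -> rs_space S2}) := \prod_j rs_mu S2 (v j).
have mup0 w : 0 <= mup w by rewrite prodr_ge0.
have nuq0 v : 0 <= nuq v by rewrite prodr_ge0.
have mup1 : \sum_w mup w = 1 by rewrite (sum_ffun_prod (fun=> rs_mu S1)) mu1 big1.
have nuq1 : \sum_v nuq v = 1 by rewrite (sum_ffun_prod (fun=> rs_mu S2)) nu1 big1.
pose Phi (w : {ffun 'I_p -> rs_space S1}) (v : {ffun 'I_q -> rs_space S2}) : R :=
  \prod_i \prod_j (rich (w i) (v j) == C)%:R.
have Phi01 w v : 0 <= Phi w v <= 1.
  rewrite prodr_ge0 /=; last by move=> i _; rewrite prodr_ge0.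
  rewrite prodr_ile1 // => i _; rewrite prodr_ge0 //= prodr_ile1 // => j _.
  by rewrite ler0n lern1 leq_b1.
have Phi0 w v : 0 <= Phi w v by case/andP: (Phi01 w v).
have box : d ^+ (p * q) <= \sum_w \sum_v mup w * nuq v * Phi w v.
  exact: (biclique_density (G := fun w v => rich w v == C)).
pose inj1 (w : {ffun 'I_p -> rs_space S1}) := injectiveb (fun i => rs_time S1 (w i)).
pose inj2 (v : {ffun 'I_q -> rs_space S2}) := injectiveb (fun j => rs_time S2 (v j)).
pose asc1 (w : {ffun 'I_p -> rs_space S1}) := ascending (fun i => rs_time S1 (w i)).
pose asc2 (v : {ffun 'I_q -> rs_space S2}) := ascending (fun j => rs_time S2 (v j)).
have col1 : \sum_w mup w * (~~ inj1 w)%:R <= (p * p)%:R / c1%:R.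
  by apply: collision_bound => //; [rewrite invr_ge0|exact: rs_time_le].
have col2 : \sum_v nuq v * (~~ inj2 v)%:R <= (q * q)%:R / c2%:R.
  by apply: collision_bound => //; [rewrite invr_ge0|exact: rs_time_le].
have remove : \sum_w \sum_v mup w * nuq v * Phi w v <=
    \sum_(w | inj1 w) \sum_(v | inj2 v) mup w * nuq v * Phi w v
    + \sum_w mup w * (~~ inj1 w)%:R + \sum_v nuq v * (~~ inj2 v)%:R.
  have -> : \sum_w mup w * (~~ inj1 w)%:R = \sum_w \sum_v mup w * (~~ inj1 w)%:R * nuq v.
    by apply: eq_bigr => w _; rewrite -mulr_sumr nuq1 mulr1.
  have -> : \sum_v nuq v * (~~ inj2 v)%:R = \sum_w \sum_v mup w * (nuq v * (~~ inj2 v)%:R).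
    by under [RHS]eq_bigr do rewrite -mulr_sumr; rewrite -mulr_suml mup1 mul1r.
  rewrite [X in X + _ + _]big_mkcond -!big_split; apply: ler_sum => w _ /=.
  rewrite (_ : (if inj1 w then _ else 0) =
    \sum_v (if inj1 w && inj2 v then mup w * nuq v * Phi w v else 0)); last first.
    case: (inj1 w) => /=; first by rewrite big_mkcond.
    by rewrite big1.
  rewrite -!big_split; apply: ler_sum => v _ /=.
  have /andP [P0 P1] := Phi01 w v.
  have X0 : 0 <= mup w * nuq v by rewrite mulr_ge0.
  have X1 : mup w * nuq v * Phi w v <= mup w * nuq v by rewrite ler_piMr.
  have X2 : 0 <= mup w * nuq v * Phi w v by rewrite mulr_ge0.
  by case: (inj1 w); case: (inj2 v) => /=; move: X0 X1 X2; lra.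
(* [Phi] makes the same demand on every pair of copies, hence is symmetric in them. *)
have sort1 v : \sum_(w | inj1 w) mup w * nuq v * Phi w v <=
    (p`!)%:R * \sum_(w | asc1 w) mup w * nuq v * Phi w v.
  apply: (@sum_over_injective R _ _ _ (rs_time S1) (fun w => mup w * nuq v * Phi w v))
    => [w|s w]; first by rewrite !mulr_ge0.
  congr (_ * _ * _); rewrite [RHS](reindex_inj (@perm_inj _ s));
    by apply: eq_bigr => i _; rewrite ?ffunE // ; apply: eq_bigr => j _; rewrite ffunE.
have sort2 w : \sum_(v | inj2 v) mup w * nuq v * Phi w v <=
    (q`!)%:R * \sum_(v | asc2 v) mup w * nuq v * Phi w v.
  apply: (@sum_over_injective R _ _ _ (rs_time S2) (fun v => mup w * nuq v * Phi w v))
    => [v|s v]; first by rewrite !mulr_ge0.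
  congr (_ * _ * _).
    by rewrite [RHS](reindex_inj (@perm_inj _ s)); apply: eq_bigr => i _; rewrite ffunE.
  apply: eq_bigr => i _; rewrite [RHS](reindex_inj (@perm_inj _ s)).
  by apply: eq_bigr => j _; rewrite ffunE.
have sorted12 : \sum_(w | inj1 w) \sum_(v | inj2 v) mup w * nuq v * Phi w v <=
    (p`! * q`!)%:R * \sum_(w | asc1 w) \sum_(v | asc2 v) mup w * nuq v * Phi w v.
  apply: le_trans (ler_sum _ (fun w _ => sort2 w)) _.
  rewrite -mulr_sumr natrM -mulrA mulrCA ler_wpM2l //.
  rewrite exchange_big [X in _ <= _ * X]exchange_big mulr_sumr /=.
  by apply: ler_sum => v _; exact: sort1.
have push1 z : \sum_w mup w * [forall i, rs_row S1 (w i) (r i) == z i]%:R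
    <= (D1 / m%:R) ^+ p.
  apply: (sum_pushforward (Z := fun i w => rs_row S1 w (r i))) => // i.
  exact: rs_row_le.
have push2 y : \sum_v nuq v * [forall j, rs_row S2 (v j) (k j) == y j]%:R
    <= (D2 / n%:R) ^+ q.
  apply: (sum_pushforward (Z := fun j v => rs_row S2 v (k j))) => // j.
  exact: rs_row_le.
have pushed : \sum_(w | asc1 w) \sum_(v | asc2 v) mup w * nuq v * Phi w v <=
   \sum_(z : {ffun 'I_p -> 'I_m}) \sum_(y : {ffun 'I_q -> 'I_n}) (good_tuple z y)%:R
     * ((\sum_w mup w * [forall i, rs_row S1 (w i) (r i) == z i]%:R) *
       (\sum_v nuq v * [forall j, rs_row S2 (v j) (k j) == y j]%:R)).
  apply: (@le_trans _ _ (\sum_w \sum_v \sum_(z : {ffun 'I_p -> 'I_m}) \sum_(y : {ffun 'I_q -> 'I_n})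
     (good_tuple z y)%:R * ((mup w * [forall i, rs_row S1 (w i) (r i) == z i]%:R) *
       (nuq v * [forall j, rs_row S2 (v j) (k j) == y j]%:R)))); last first.
    under eq_bigr do rewrite exchange_big.
    rewrite exchange_big /=; apply: ler_sum => z _.
    under eq_bigr do rewrite exchange_big.
    rewrite exchange_big /=; apply: ler_sum => y _.
    rewrite mulr_suml mulr_sumr; apply: ler_sum => w _.
    by rewrite mulr_sumr mulr_sumr; apply: ler_sum => v _.
  have term0 w v z y : 0 <= (good_tuple z y)%:R *
      ((mup w * [forall i, rs_row S1 (w i) (r i) == z i]%:R) *
       (nuq v * [forall j, rs_row S2 (v j) (k j) == y j]%:R)) by rewrite !mulr_ge0.
  have outer0 w v : 0 <= \sum_(z : {ffun 'I_p -> 'I_m}) \sum_(y : {ffun 'I_q -> 'I_n})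
      (good_tuple z y)%:R * ((mup w * [forall i, rs_row S1 (w i) (r i) == z i]%:R) *
       (nuq v * [forall j, rs_row S2 (v j) (k j) == y j]%:R)).
    by rewrite sumr_ge0 // => z _; rewrite sumr_ge0.
  rewrite big_mkcond; apply: ler_sum => w _; case: ifP => [a1|_]; last by rewrite sumr_ge0.
  rewrite big_mkcond; apply: ler_sum => v _; case: ifP => [a2|_]; last exact: outer0.
  have [z0|nz] := eqVneq (mup w * nuq v * Phi w v) 0; first by rewrite z0.
  pose z : {ffun 'I_p -> 'I_m} := [ffun i => rs_row S1 (w i) (r i)].
  pose y : {ffun 'I_q -> 'I_n} := [ffun j => rs_row S2 (v j) (k j)].
  rewrite (bigD1 z) //= (bigD1 y) //= -addrA.
  have zE : [forall i, rs_row S1 (w i) (r i) == z i] by apply/forallP => i; rewrite ffunE.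
  have yE : [forall i, rs_row S2 (v i) (k i) == y i] by apply/forallP => i; rewrite ffunE.
  have [muN nuN PhiN] : [/\ mup w != 0, nuq v != 0 & Phi w v != 0].
    by move: nz; rewrite !mulf_eq0 !negb_or => /andP [/andP [-> ->] ->].
  (* [rs_order] concerns outcomes of positive probability only, which a nonzero term guarantees. *)
  have muP i : 0 < rs_mu S1 (w i).
    rewrite lt_def mu0 andbT; apply: contraNneq muN => e.
    by rewrite /mup (bigD1 i) //= e mul0r.
  have nuP j : 0 < rs_mu S2 (v j).
    rewrite lt_def nu0 andbT; apply: contraNneq nuN => e.
    by rewrite /nuq (bigD1 j) //= e mul0r.
  have PhiP i j : rich (w i) (v j) = C.
    apply/eqP; apply: contraNT PhiN => e.
    by rewrite /Phi (bigD1 i) //= (bigD1 j) //= (negPf e) !mul0r.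
  have -> : good_tuple z y.
    apply/and3P; split.
    - apply/ascendingP => i i' lt; rewrite !ffunE; apply: rs_order => //; first exact: r_mono.
      by move/ascendingP: a1; apply.
    - apply/ascendingP => j j' lt; rewrite !ffunE; apply: rs_order => //; first exact: k_mono.
      by move/ascendingP: a2; apply.
    - apply/forallP => i; apply/forallP => j; apply/forallP => s; apply/implyP.
      by rewrite -(PhiP i j) !ffunE inE.
  rewrite zE yE !mulr1 mul1r.
  apply: (@le_trans _ _ (mup w * nuq v)).
    by rewrite ler_piMr ?mulr_ge0 //; case/andP: (Phi01 w v).
  rewrite lerDl addr_ge0 //; apply: sumr_ge0 => y' _; first by rewrite !mulr_ge0.
  by apply: sumr_ge0 => y'' _; rewrite !mulr_ge0.
have final : \sum_(z : {ffun 'I_p -> 'I_m}) \sum_(y : {ffun 'I_q -> 'I_n}) (good_tuple z y)%:R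
     * ((\sum_w mup w * [forall i, rs_row S1 (w i) (r i) == z i]%:R) *
       (\sum_v nuq v * [forall j, rs_row S2 (v j) (k j) == y j]%:R)) <=
   (\sum_z \sum_v (good_tuple z v)%:R) * ((D1 / m%:R) ^+ p * (D2 / n%:R) ^+ q).
  rewrite mulr_suml; apply: ler_sum => z _; rewrite mulr_suml; apply: ler_sum => y _.
  rewrite ler_wpM2l // ler_pM // sumr_ge0 // => *; by rewrite mulr_ge0.
rewrite -[leRHS]mulrA -[leRHS]mulrA.
have := ler_wpM2l (ler0n R (p`! * q`!)) (le_trans pushed final).
by move: box remove col1 col2 sorted12; lra.
Qed.

End Blowup.
End Core.

(** * From a popular model to many violating submatrices *)

Lemma uniform_bound (T : finType) (Q : T -> nat -> Prop) :
  (forall x k l, (k <= l)%N -> Q x k -> Q x l) -> (forall x, exists k, Q x k) ->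
  exists k, forall x, Q x k.
Proof.
move=> mono /choice [f fP]; exists (\max_x f x)%N => x.
by apply: mono (fP x); exact: leq_bigmax.
Qed.

Section Detection.
Variables (Sigma : finType) (P : mxproperty Sigma).

(** Sampled lines may repeat and come in any order, so the violation is an ordered submatrix on some
    of them. *)
Definition witness (m n : nat) (M : 'M[Sigma]_(m.+1, n.+1)) (p q : nat)
    (z : 'I_p -> 'I_m.+1) (v : 'I_q -> 'I_n.+1) : Prop :=
  exists k l (a : 'I_k.+1 -> 'I_m.+1) (b : 'I_l.+1 -> 'I_n.+1),
    [/\ {homo a : i j / (i < j)%N}, {homo b : i j / (i < j)%N},
      forall i, exists i', z i' = a i, forall j, exists j', v j' = b j
      & ~ P (mxsub a b M)].

(** A proportion of at least [1 / N] of the samples, cleared of denominators; the same [N] bounds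
    [p] and [q], so that bounds combine by maxima. *)
Definition detects (N m n : nat) (M : 'M[Sigma]_(m.+1, n.+1)) : Prop :=
  exists p q, [/\ (p <= N)%N, (q <= N)%N &
    (m.+1 ^ p * n.+1 ^ q <= N * #|[set zv : {ffun 'I_p -> 'I_m.+1} * {ffun 'I_q -> 'I_n.+1}
       | `[< witness M zv.1 zv.2 >]]|)%N].

Lemma detects_mono N N' m n (M : 'M[Sigma]_(m.+1, n.+1)) :
  (N <= N')%N -> detects N M -> detects N' M.
Proof.
move=> le [p [q [lp lq lN]]]; exists p, q.
by split; [exact: leq_trans lp le|exact: leq_trans lq le|apply: leq_trans lN _; exact: leq_mul].
Qed.

(** Only the model enters, not the input matrix, so sizes of patterns can be bounded beforehand. *)
Definition forbidden_model (b1 b2 : bool) (u1 u2 t : nat)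
    (C : {ffun cells u1 u2 t -> {set Sigma}}) (p q : nat) : Prop :=
  exists (F : 'M[Sigma]_(p.+1, q.+1)) (r : 'I_p.+1 -> 'I_u1 * 'I_t) (k : 'I_q.+1 -> 'I_u2 * 'I_t),
  [/\ forall i i' : 'I_p.+1, (i < i')%N -> slot_rel b1 (r i).1 (r i').1,
      forall j j' : 'I_q.+1, (j < j')%N -> slot_rel b2 (k j).1 (k j').1,
      forall i j, F i j \in C (r i, k j)
    & ~ P F].

(** There are finitely many models, so one bound, obtained by choice, serves all of them. *)
Lemma forbidden_size (b1 b2 : bool) (u1 u2 t : nat) : exists K, 
  forall C : {ffun cells u1 u2 t -> {set Sigma}},
  (exists p q, forbidden_model b1 b2 C p q) ->
  exists p q, [/\ (p <= K)%N, (q <= K)%N & forbidden_model b1 b2 C p q].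
Proof.
apply: (uniform_bound (Q := fun C K => (exists p q, forbidden_model b1 b2 C p q) ->
  exists p q, [/\ (p <= K)%N, (q <= K)%N & forbidden_model b1 b2 C p q])).
  move=> C k l kl H /H [p [q [pk qk F]]]; exists p, q.
  by split=> //; [exact: leq_trans pk kl|exact: leq_trans qk kl].
move=> C; have [[p [q F]]|no] := pselect (exists p q, forbidden_model b1 b2 C p q).
  by exists (maxn p q) => _; exists p, q; rewrite leq_maxl leq_maxr.
by exists 0%N => /no.
Qed.

End Detection.

Section CoreDetection.
Variables (R : realType) (Sigma : finType) (P : mxproperty Sigma) (b1 b2 : bool).
Variables (m n u1 u2 t c1 c2 : nat) (tau1 : 'I_m.+1 -> 'I_t) (tau2 : 'I_n.+1 -> 'I_t).
Variables (D e1 e2 : R).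
Variables (S1 : rep_system b1 u1 c1 tau1 D e1) (S2 : rep_system b2 u2 c2 tau2 D e2).
Variables (M : 'M[Sigma]_(m.+1, n.+1)) (W : Sigma -> 'I_m.+1 * 'I_n.+1 -> R) (gam eps : R).

Let Mf : 'I_m.+1 -> 'I_n.+1 -> Sigma := fun x y => M x y.
Let mn0 : 0 < m.+1%:R * n.+1%:R :> R. Proof. by rewrite mulr_gt0. Qed.

(** By Markov's inequality the random model has few misfits with probability at least one half,
    while models rarer than [p0] have total mass at most [1 / 4]. *)
Lemma popular_model (p0 : R) : 0 < eps -> 0 <= p0 ->
  #|{ffun cells u1 u2 t -> {set Sigma}}|%:R * p0 <= 1 / 4 ->
  \sum_w \sum_v rs_mu S1 w * rs_mu S2 v * misfits S1 S2 Mf (rich W gam w v)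
    <= eps / 2 * m.+1%:R * n.+1%:R ->
  exists C, misfits S1 S2 Mf C < eps * m.+1%:R * n.+1%:R /\
    p0 <= \sum_w \sum_v rs_mu S1 w * rs_mu S2 v * (rich W gam w v == C)%:R.
Proof.
move=> eps0 p00 Zp Em; apply: contrapT => none.
have mu0 := rs_mu_ge0 S1; have nu0 := rs_mu_ge0 S2.
have tot : \sum_w \sum_v rs_mu S1 w * rs_mu S2 v = 1.
  by under eq_bigr do rewrite -mulr_sumr rs_mu_sum mulr1; rewrite rs_mu_sum.
set L := eps * m.+1%:R * n.+1%:R in none.
have L0 : 0 < L by rewrite /L -mulrA mulr_gt0.
pose ok (C : {ffun cells u1 u2 t -> {set Sigma}}) : bool := misfits S1 S2 Mf C < L.
have small : \sum_w \sum_v rs_mu S1 w * rs_mu S2 v * (ok (rich W gam w v))%:R <= 1 / 4.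
  apply: le_trans Zp; rewrite mulr_natl -sumr_const.
  apply: (@le_trans _ _ (\sum_(C : {ffun cells u1 u2 t -> {set Sigma}}) \sum_w \sum_v
      rs_mu S1 w * rs_mu S2 v * ((rich W gam w v == C) && ok C)%:R)).
    rewrite [leRHS]exchange_big; apply: ler_sum => w _.
    rewrite [leRHS]exchange_big; apply: ler_sum => v _ /=.
    rewrite (bigD1 (rich W gam w v)) //= eqxx lerDl sumr_ge0 // => C _.
    by rewrite !mulr_ge0.
  apply: ler_sum => C _; case okC : (ok C).
    rewrite leNgt; apply/negP => big; apply: none; exists C; split; first exact: okC.
    by apply: ltW; under eq_bigr do under eq_bigr do rewrite -[_ == C]andbT.
  apply: le_trans p00; rewrite big1 // => w _; rewrite big1 // => v _.
  by rewrite andbF mulr0.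
have markov : L * (1 - \sum_w \sum_v rs_mu S1 w * rs_mu S2 v * (ok (rich W gam w v))%:R)
    <= eps / 2 * m.+1%:R * n.+1%:R.
  apply: le_trans Em; rewrite -{1}tot -sumrB mulr_sumr; apply: ler_sum => w _.
  rewrite -sumrB mulr_sumr; apply: ler_sum => v _.
  rewrite -[X in X - _]mulr1 -mulrBr mulrCA ler_wpM2l ?mulr_ge0 // /ok.
  case: ltrP => /= [_|le]; last by rewrite subr0 mulr1.
  by rewrite subrr mulr0 sumr_ge0 // => x _; rewrite sumr_ge0.
have : L * (1 - 1 / 4) <= eps / 2 * m.+1%:R * n.+1%:R.
  by apply: le_trans markov; rewrite ler_pM2l // lerB.
by rewrite /L; nra.
Qed.

(** Misfits are recoloured with allowed colours. The result [N] is too close to [M] to have the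
    property, and is itself the pattern. *)
Lemma far_model (C : {ffun cells u1 u2 t -> {set Sigma}}) :
  far P eps M -> misfits S1 S2 Mf C < eps * m.+1%:R * n.+1%:R ->
  (forall c, C c != set0) -> exists p q, forbidden_model P b1 b2 C p q.
Proof.
move=> farM few C0.
pose cell x y : cells u1 u2 t := (row_cell S1 x, col_cell S2 y).
pose N : 'M[Sigma]_(m.+1, n.+1) := \matrix_(x, y)
  if M x y \in C (cell x y) then M x y else odflt (M x y) [pick s in C (cell x y)].
have NC x y : N x y \in C (cell x y).
  rewrite mxE; case: ifP => // _; case: pickP => //= none.
  by have /set0Pn [s] := C0 (cell x y); rewrite none.
exists m, n, N, (row_cell S1), (col_cell S2); split.
- exact: rs_slot_mono.
- exact: rs_slot_mono.
- exact: NC.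
- move=> PN; have := farM N PN; rewrite leNgt => /negP; apply.
  apply: le_lt_trans few; rewrite /misfits /hamming pair_big /= -sum1_card natr_sum.
  rewrite big_mkcond; apply: ler_sum => -[x y] _ /=; rewrite inE mxE /=.
  by rewrite /cell; case: (_ \in _); rewrite ?eqxx //=; case: eqP.
Qed.

(** Some colour has density at least the average [1 / #|Sigma|], which exceeds [gam]. *)
Lemma rich_neq0 w v : (forall x, \sum_s W s x = 1) -> #|Sigma|%:R * gam < 1 ->
  forall c, rich (S1 := S1) (S2 := S2) W gam w v c != set0.
Proof.
move=> W1 gam1 c; rewrite ffunE; apply/eqP => e.
have : \sum_s W s (rs_row S1 w c.1, rs_row S2 v c.2) <= #|Sigma|%:R * gam.
  rewrite mulr_natl -sumr_const; apply: ler_sum => s _.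
  have := in_set0 s; rewrite -e inE => /negbT.
  by rewrite -ltNge => /ltW.
by rewrite W1; move: gam1; lra.
Qed.

(** The counting lemma is used with the weight [G] that both tuples ascend. On the side of [W] a
    good tuple contributes at least a power of [gam]; on the side of the matrix the product
    indicates a copy of [F], which is a witness. *)
Lemma forbidden_count (p q : nat) (F : 'M[Sigma]_(p.+1, q.+1))
    (C : {ffun cells u1 u2 t -> {set Sigma}})
    (r : 'I_p.+1 -> 'I_u1 * 'I_t) (k : 'I_q.+1 -> 'I_u2 * 'I_t) (th : R) :
  ~ P F -> (forall i j, F i j \in C (r i, k j)) ->
  0 <= gam -> (forall s w, 0 <= W s w <= 1) -> cut_close Mf th W ->
  gam ^+ (p.+1 * q.+1) * (\sum_z \sum_v (good_tuple W gam C r k z v)%:R)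
    - (p.+1 * q.+1)%:R * (th * m.+1%:R ^+ p.+1 * n.+1%:R ^+ q.+1) <=
  #|[set zv : {ffun 'I_p.+1 -> 'I_m.+1} * {ffun 'I_q.+1 -> 'I_n.+1}
       | `[< witness P M zv.1 zv.2 >]]|%:R.
Proof.
move=> nPF FC gam0 W01 cut.
pose f (i : 'I_p.+1) (j : 'I_q.+1) x y : R := (M x y == F i j)%:R.
pose V (i : 'I_p.+1) (j : 'I_q.+1) x y : R := W (F i j) (x, y).
pose G (z : {ffun 'I_p.+1 -> 'I_m.+1}) (v : {ffun 'I_q.+1 -> 'I_n.+1}) : R :=
  (ascending z && ascending v)%:R.
pose s := enum {: 'I_p.+1 * 'I_q.+1}.
have size_s : size s = (p.+1 * q.+1)%N by rewrite -cardE card_prod !card_ord.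
have Vcut i j (A : {set 'I_m.+1}) (B : {set 'I_n.+1}) :
    \sum_(x in A) \sum_(y in B) (V i j x y - f i j x y) <= th * #|'I_m.+1|%:R * #|'I_n.+1|%:R.
  rewrite pair_big /=; apply: le_trans (cut (F i j) A B); rewrite -normrN.
  apply: le_trans (ler_norm _); rewrite -sumrN le_eqVlt; apply/orP; left; apply/eqP.
  apply: eq_big => -[x y]; first by rewrite inE.
  by rewrite /= /V /f /ind /Mf /= opprB.
have f01 i j x y : 0 <= f i j x y <= 1 by rewrite ler0n lern1 leq_b1.
have V01 i j x y : 0 <= V i j x y <= 1 by exact: W01.
have rectG e : e \in s -> rectangular e.1 e.2 G.
  move=> _ z v; exists (fun x => (ascending (upd z e.1 x))%:R), (fun y => (ascending (upd v e.2 y))%:R).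
  split=> [x|y|x y]; rewrite ?ler0n ?lern1 ?leq_b1 // /G.
  by case: ascending; rewrite ?mul1r ?mul0r.
have := counting f01 V01 _ _ Vcut (enum_uniq _) rectG.
rewrite !card_ord -/s size_s => /(_ isT isT) H.
suff [lower upper] : gam ^+ (p.+1 * q.+1) * (\sum_z \sum_v (good_tuple W gam C r k z v)%:R) <=
    \sum_z \sum_v G z v * \prod_(e <- s) V e.1 e.2 (z e.1) (v e.2) /\
  \sum_z \sum_v G z v * \prod_(e <- s) f e.1 e.2 (z e.1) (v e.2) <=
  #|[set zv : {ffun 'I_p.+1 -> 'I_m.+1} * {ffun 'I_q.+1 -> 'I_n.+1}
       | `[< witness P M zv.1 zv.2 >]]|%:R by move: H lower upper; lra.
split.
- rewrite mulr_sumr; apply: ler_sum => z _; rewrite mulr_sumr; apply: ler_sum => v _.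
  rewrite /good_tuple /G; case: (ascending z); case: (ascending v); rewrite /= ?mulr0 ?mul0r // mul1r.
  case: forallP => [all|_]; last first.
    by rewrite mulr0 prodr_ge0 // => e _; case/andP: (V01 e.1 e.2 (z e.1) (v e.2)).
  rewrite mulr1 (_ : gam ^+ _ = \prod_(e <- s) gam); last first.
    by rewrite /s big_enum /= prodr_const card_prod !card_ord.
  apply: ler_prod => -[i j] _; rewrite gam0 /=.
  by have /forallP /(_ j) /forallP /(_ (F i j)) /implyP /(_ (FC i j)) := all i.
- rewrite pair_big /= -sum1_card natr_sum [leRHS]big_mkcond; apply: ler_sum => -[z v] _ /=.
  rewrite /G inE /=; case: (boolP (ascending z)) => az; last by rewrite mul0r; case: ifP.
  case: (boolP (ascending v)) => av; last by rewrite mul0r; case: ifP.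
  rewrite mul1r; have [all|/allPn [e es ne]] := boolP (all (fun e => M (z e.1) (v e.2) == F e.1 e.2) s).
    rewrite ifT; last first.
      apply/asboolP; exists p, q, z, v; split.
      - exact/ascendingP.
      - exact/ascendingP.
      - by move=> i; exists i.
      - by move=> j; exists j.
      - suff -> : mxsub z v M = F by [].
        apply/matrixP => i j; rewrite mxE.
        by have /(_ (i, j)) := allP all _; rewrite mem_enum => /(_ isT) /eqP.
    by rewrite big_seq big1 // => e es; rewrite /f (allP all).
  rewrite (perm_big _ (perm_to_rem es)) /= big_cons /f (negPf ne) /= mul0r.
  by case: ifP.
Qed.

End CoreDetection.

(** The order of the quantifiers matters: slots and types determine [p0] and the pattern size, these
    determine how many sub-blocks make collisions harmless, then [D] is given, and only then are
    [th] and [N] chosen. *)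
Lemma core_detection (R : realType) (Sigma : finType) (P : mxproperty Sigma) (b1 b2 : bool)
    (u1 u2 t : nat) (gam eps : R) :
  0 < gam -> gam <= 1 -> #|Sigma|%:R * gam < 1 -> 0 < eps ->
  exists c0 : nat, forall c1 c2 : nat, (c0 <= c1)%N -> (c0 <= c2)%N -> forall D : R, 1 <= D ->
  exists th : R, 0 < th /\ exists N : nat,
  forall (m n : nat) (M : 'M[Sigma]_(m.+1, n.+1)) (tau1 : 'I_m.+1 -> 'I_t) (tau2 : 'I_n.+1 -> 'I_t)
    (e1 e2 d : R) (S1 : rep_system b1 u1 c1 tau1 D e1) (S2 : rep_system b2 u2 c2 tau2 D e2)
    (W : Sigma -> 'I_m.+1 * 'I_n.+1 -> R) (g : Sigma -> 'I_t -> 'I_t -> R),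
  (forall s w, 0 <= W s w <= 1) -> (forall x, \sum_s W s x = 1) ->
  (forall s a a', 0 <= g s a a' <= 1) -> cut_close (fun x y => M x y) th W ->
  \sum_s \sum_x \sum_y `|W s (x, y) - g s (tau1 x) (tau2 y)| <= d * m.+1%:R * n.+1%:R ->
  d + d + #|Sigma|%:R * (e1 + e2 + gam) <= eps / 4 ->
  far P eps M -> detects P N M.
Proof.
move=> gam0 gam1 gamS eps0.
have [k0 HK] := forbidden_size P b1 b2 u1 u2 t.
pose Z : R := #|{ffun cells u1 u2 t -> {set Sigma}}|%:R.
have Z0 : 1 <= Z by rewrite ler1n; apply/card_gt0P; exists [ffun=> set0].
pose p0 : R := (4 * Z)^-1.
have p00 : 0 < p0 by rewrite invr_gt0; lra.
have p01 : p0 <= 1 by rewrite invf_le1; lra.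
have Zp0 : Z * p0 <= 1 / 4 by rewrite /p0 invfM mulrCA divff ?gt_eqF //; lra.
(* Patterns have at most [k0.+1] rows and columns, since [forbidden_model] counts from predecessors;
   [K] bounds their number of entries. *)
pose K := (k0.+1 * k0.+1)%N.
have p0K : 0 < p0 ^+ K by rewrite exprn_gt0.
(* Each of the two collision terms is then at most [p0 ^+ K / 4], so half of [p0 ^+ K] survives. *)
pose c0 := (Num.bound (4 * K%:R / p0 ^+ K)).+1.
exists c0 => c1 c2 le1 le2 D D1.
have Kc c : (c0 <= c)%N -> K%:R / c%:R <= p0 ^+ K / 4.
  move=> le; have c_gt0 : 0 < c%:R :> R by rewrite ltr0n; exact: leq_trans le.
  rewrite ler_pdivrMr //.
  have : 4 * K%:R / p0 ^+ K < c%:R.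
    apply: lt_le_trans (archi_boundP _) _; first by rewrite !mulr_ge0 ?invr_ge0 // ltW.
    by rewrite ler_nat; apply: leq_trans le; exact: leqnSn.
  by rewrite ltr_pdivrMr //; lra.
pose B : R := ((k0.+1)`! * (k0.+1)`!)%:R * D ^+ (k0.+1 + k0.+1).
have D0 : 0 < D by lra.
have B0 : 0 < B by rewrite mulr_gt0 ?exprn_gt0 // ltr0n muln_gt0 !fact_gt0.
pose del := gam ^+ K * (p0 ^+ K / 2 / B).
have del0 : 0 < del by rewrite /del mulr_gt0 ?exprn_gt0 // !divr_gt0.
pose cel : R := (#|Sigma| * #|{: cells u1 u2 t}|)%:R.
(* The first bound keeps the cost of replacing the matrix by [W] below [eps / 4]; the second keeps
   the counting error below half of [del]. *)
pose th := Num.min (eps / 4 / (cel + 1)) (del / 2 / K%:R).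
have K0 : 0 < K%:R :> R by rewrite ltr0n.
have cel0 : 0 <= cel by rewrite ler0n.
have th0 : 0 < th by rewrite lt_min !divr_gt0 //; lra.
have th_cel : cel * th <= eps / 4.
  apply: (@le_trans _ _ (cel * (eps / 4 / (cel + 1)))).
    by rewrite ler_wpM2l // ge_min lexx.
  by rewrite mulrA ler_pdivrMr; nra.
have th_K : K%:R * th <= del / 2.
  rewrite mulrC -ler_pdivlMr //; by rewrite ge_min lexx orbT.
exists th; split=> //; exists (maxn k0.+1 (Num.bound (2 / del))).
move=> m n M tau1 tau2 e1 e2 d S1 S2 W g W01 W1 g01 cut L1 budget farM.
have mn0 : 0 < m.+1%:R * n.+1%:R :> R by rewrite mulr_gt0.
have Em : \sum_w \sum_v rs_mu S1 w * rs_mu S2 v *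
    misfits S1 S2 (fun x y => M x y) (rich W gam w v) <= eps / 2 * m.+1%:R * n.+1%:R.
  apply: le_trans (expected_misfits S1 S2 cut (ltW th0) g01 (ltW gam0) L1) _.
  rewrite -[leLHS]mulrA -[leRHS]mulrA ler_pM2r //; move: th_cel budget; rewrite /cel; lra.
have [C [few pop]] := popular_model eps0 (ltW p00) Zp0 Em.
(* A model of positive probability is realised by some outcome, to which [rich_neq0] applies. *)
have C0 c : C c != set0.
  apply: contrapT => /negP; rewrite negbK => /eqP Cc.
  suff : p0 <= 0 by move: p00; lra.
  apply: le_trans pop _; rewrite big1 // => w _; rewrite big1 // => v _.
  case: eqP => [e|_]; last by rewrite mulr0.
  by have := rich_neq0 w v W1 gamS c; rewrite e Cc eqxx.
have [p [q [pk qk [F [r [k [r_mono k_mono FC nPF]]]]]]] := HK C (far_model farM few C0).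
have tuples := good_tuples r_mono k_mono (ltW p00) pop.
have count := forbidden_count nPF FC (ltW gam0) W01 cut.
exists p.+1, q.+1; split; try by rewrite leq_max ltnS ?pk ?qk.
set G := \sum_z \sum_v (good_tuple _ _ _ _ _ _ _)%:R in tuples count.
set X := #|_|%:R in count.
have pqK : (p.+1 * q.+1 <= K)%N by apply: leq_mul.
have G0 : 0 <= G by rewrite sumr_ge0 // => z _; rewrite sumr_ge0.
have mp : 0 < m.+1%:R ^+ p.+1 :> R by rewrite exprn_gt0.
have nq : 0 < n.+1%:R ^+ q.+1 :> R by rewrite exprn_gt0.
have lowG : p0 ^+ K / 2 * (m.+1%:R ^+ p.+1 * n.+1%:R ^+ q.+1) <= B * G.
  have h1 : p0 ^+ K <= p0 ^+ (p.+1 * q.+1) by rewrite ler_wiXn2l // ltW.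
  have h2 : (p.+1 * p.+1)%:R / c1%:R <= p0 ^+ K / 4.
    apply: le_trans (Kc c1 le1); rewrite ler_wpM2r ?invr_ge0 // ler_nat; exact: leq_mul.
  have h3 : (q.+1 * q.+1)%:R / c2%:R <= p0 ^+ K / 4.
    apply: le_trans (Kc c2 le2); rewrite ler_wpM2r ?invr_ge0 // ler_nat; exact: leq_mul.
  have h4 : p0 ^+ K / 2 <= ((p.+1)`! * (q.+1)`!)%:R * G * (D / m.+1%:R) ^+ p.+1 * (D / n.+1%:R) ^+ q.+1.
    by move: tuples h1 h2 h3; lra.
  rewrite -ler_pdivlMr ?mulr_gt0 //; apply: le_trans h4 _.
  rewrite !expr_div_n.
  have -> : ((p.+1)`! * (q.+1)`!)%:R * G * (D ^+ p.+1 / m.+1%:R ^+ p.+1) * (D ^+ q.+1 / n.+1%:R ^+ q.+1)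
     = (((p.+1)`! * (q.+1)`!)%:R * (D ^+ p.+1 * D ^+ q.+1)) * G / (m.+1%:R ^+ p.+1 * n.+1%:R ^+ q.+1).
    by rewrite invfM; ring.
  rewrite ler_wpM2r ?invr_ge0 ?mulr_ge0 ?exprn_ge0 // ler_wpM2r //.
  rewrite ler_pM // ?mulr_ge0 ?exprn_ge0 ?(ltW D0) //.
    by rewrite ler_nat leq_mul // leq_fact.
  by rewrite -exprD ler_weXn2l // leq_add.
have lowX : del / 2 * (m.+1%:R ^+ p.+1 * n.+1%:R ^+ q.+1) <= X.
  have h1 : gam ^+ K * G <= gam ^+ (p.+1 * q.+1) * G.
    by rewrite ler_wpM2r // ler_wiXn2l // ltW.
  have h2 : (p.+1 * q.+1)%:R * (th * m.+1%:R ^+ p.+1 * n.+1%:R ^+ q.+1)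
      <= del / 2 * (m.+1%:R ^+ p.+1 * n.+1%:R ^+ q.+1).
    rewrite -[th * _ * _]mulrA mulrA ler_pM2r ?mulr_gt0 //; apply: le_trans th_K.
    by rewrite ler_wpM2r ?ler_nat // ltW.
  have h3 : del * (m.+1%:R ^+ p.+1 * n.+1%:R ^+ q.+1) <= gam ^+ K * G.
    rewrite /del -!mulrA ler_pM2l ?exprn_gt0 // mulrA [B^-1 * _]mulrC mulrA ler_pdivrMr //.
    by rewrite mulrC [G * _]mulrC mulrC.
  by move: count h1 h2 h3; lra.
have : 2 / del <= (maxn k0.+1 (Num.bound (2 / del)))%:R.
  apply: le_trans (ltW (archi_boundP _)) _; first by rewrite divr_ge0 // ltW.
  by rewrite ler_nat leq_maxr.
rewrite -(ler_nat R) natrM !natrX natrM -/X ler_pdivrMr // => bound.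
set NN : R := (maxn _ _)%:R in bound *.
have X0 : 0 <= X by rewrite ler0n.
have : del / 2 * (m.+1%:R ^+ p.+1 * n.+1%:R ^+ q.+1) <= del / 2 * (NN * X).
  apply: le_trans lowX _.
  by nra.
by rewrite ler_pM2l // divr_gt0.
Qed.

(** * Systems of representatives for a bounded dimension *)

Lemma ffun_marginal (R : realType) (I T : finType) (G : I -> T -> R) (i0 : I) (phi : T -> R) :
  (forall i, \sum_x G i x = 1) ->
  \sum_(f : {ffun I -> T}) (\prod_i G i (f i)) * phi (f i0) = \sum_x G i0 x * phi x.
Proof.
move=> G1.
pose H i x := G i x * (if i == i0 then phi x else 1).
transitivity (\prod_i \sum_x H i x).
  rewrite -sum_ffun_prod; apply: eq_bigr => f _; rewrite big_split /=; congr (_ * _).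
  by rewrite (bigD1 i0) //= eqxx big1 ?mulr1 // => i /negPf ->.
rewrite (bigD1 i0) //= [X in _ * X]big1 ?mulr1; last first.
  by move=> i /negPf ne; rewrite -[RHS](G1 i); apply: eq_bigr => x _; rewrite /H ne mulr1.
by apply: eq_bigr => x _; rewrite /H eqxx.
Qed.

(** Every row is a slot and represents itself, so nothing is lost in [rs_near]. A single row may
    carry the full mass, which is within [D / m] as [m <= D]. *)
Lemma discrete_system (R : realType) (m t c : nat) (tau : 'I_m -> 'I_t) (D : R) :
  (0 < m)%N -> (0 < c)%N -> m%:R <= D -> rep_system true m c tau D 0.
Proof.
move=> m0 c0 mD.
have cN : c%:R != 0 :> R by rewrite pnatr_eq0 -lt0n.
have one : \sum_(w < c) c%:R^-1 = 1 :> R.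
  by rewrite sumr_const card_ord -[LHS]mulr_natl divff.
refine (@RepSystem R true m m t c tau D 0 id 'I_c (fun=> c%:R^-1) (fun _ a => a.1) id
  _ _ _ _ _ _ _) => //.
- by move=> w; rewrite invr_ge0.
- by move=> j; rewrite (big_pred1 j).
- move=> a z; have m0' : 0 < m%:R :> R by rewrite ltr0n.
  case: (a.1 == z); last first.
    by rewrite big_pred0_eq divr_ge0 // ltW // (lt_le_trans m0').
  by rewrite one ler_pdivlMr // mul1r.
- move=> psi psi01; rewrite mul0r addr0; apply: ler_sum => x _.
  by rewrite -mulr_suml one mul1r.
Qed.

(** * Sizes of intervals *)

Section IntervalSize.
Variables (m k s : nat).
Hypothesis (k0 : (0 < k)%N) (km : (k <= m)%N).

Let block := [set x : 'I_m | ((x * k) %/ m == s)%N].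

Let blockP (x : 'I_m) : (x \in block) = (s * m <= x * k < s * m + m)%N.
Proof.
have m0 : (0 < m)%N by exact: leq_trans km.
by rewrite inE eqn_leq andbC leq_divRL // -[X in _ && X]ltnS ltn_divLR // mulSn addnC.
Qed.

(** An interval of real length [m / k] has at most [m %/ k + 1] integers, and [m / k] is at least
    one. *)
Lemma interval_upper : (#|block| * k <= 2 * m)%N.
Proof.
have m0 : (0 < m)%N by exact: leq_trans km.
have sub : (#|block| <= (m %/ k).+1)%N.
  rewrite -[leqRHS]card_ord.
  pose x0 := ((s * m) %/ k)%N.
  pose x1 := ((s * m + k.-1) %/ k)%N.
  have x1P (x : 'I_m) : x \in block -> (x1 <= x /\ x - x1 < (m %/ k).+1)%N.
    rewrite blockP => /andP [lo hi].
    have l1 : (x1 <= x)%N by rewrite -ltnS ltn_divLR // mulSn; lia.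
    split=> //; rewrite ltnS leq_divRL // mulnBl.
    have : (s * m <= x1 * k)%N.
      have := ltn_ceil (s * m + k.-1) k0; rewrite -/x1 mulSn; lia.
    lia.
  apply: (@leq_card_in _ _ (fun x : 'I_m => inord (x - x1))).
  move=> x y /x1P [lx ux] /x1P [ly uy] /(congr1 val); rewrite /= !inordK // => e.
  by apply: val_inj => /=; lia.
have := leq_trunc_div m k; nia.
Qed.

(** The [m %/ k] integers from the ceiling [x0] of [s m / k] on lie in the block, and rounding down
    [m / k] loses less than half of it. *)
Lemma interval_lower : (s < k)%N -> (m <= 2 * (#|block| * k))%N.
Proof.
move=> sk; have m0 : (0 < m)%N by exact: leq_trans km.
have sub : (m %/ k <= #|block|)%N.
  pose x0 := ((s * m + k.-1) %/ k)%N.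
  have lo : (s * m <= x0 * k)%N.
    have := ltn_ceil (s * m + k.-1) k0; rewrite -/x0 mulSn; lia.
  have hi : (x0 * k <= s * m + k.-1)%N by exact: leq_trunc_div.
  have mk : (m %/ k * k <= m)%N by exact: leq_trunc_div.
  have inb (i : 'I_(m %/ k)) : ((x0 + i) * k < s * m + m)%N.
    have : (i.+1 * k <= m %/ k * k)%N by rewrite leq_mul2r ltn_ord orbT.
    move: hi mk; rewrite mulSn mulnDl.
    by move: (x0 * k)%N (i * k)%N (m %/ k * k)%N (s * m)%N => A B C E; lia.
  have ltm (i : 'I_(m %/ k)) : (x0 + i < m)%N.
    have : (s.+1 * m <= k * m)%N by rewrite leq_mul2r sk orbT.
    rewrite -(ltn_pmul2r k0) mulSn [(m * k)%N]mulnC; have := inb i.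
    by move: ((x0 + i) * k)%N (s * m)%N (k * m)%N => A B C; lia.
  rewrite -[leqLHS]card_ord -(card_imset _ (f := fun i : 'I_(m %/ k) => Ordinal (ltm i))).
    apply/subset_leq_card/subsetP => x /imsetP [i _ ->]; rewrite blockP /= inb andbT.
    by rewrite mulnDl; lia.
  by move=> i j /(congr1 val) /= e; apply: val_inj => /=; lia.
have := ltn_ceil m k0; have : (1 <= m %/ k)%N by rewrite divn_gt0.
rewrite mulSn; nia.
Qed.

End IntervalSize.

Lemma sum_grid (R : realType) (u c : nat) (F : nat -> R) :
  \sum_(i < u * c) F i = \sum_(s < u) \sum_(j < c) F (s * c + j)%N.
Proof.
rewrite -(big_mkord xpredT F) big_nat_mul big_mkord; apply: eq_bigr => s _.
rewrite -{1}[(s * c)%N]add0n big_addn mulSn addnK big_mkord.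
by apply: eq_bigr => j _; rewrite addnC.
Qed.

(** * Equidistribution of types in sub-blocks by an energy argument *)

Section Equidistribution.
Variables (R : realType) (m t : nat) (tau : 'I_m -> 'I_t).

Definition block_count (k s : nat) (a : 'I_t) : nat :=
  #|[set x : 'I_m | ((x * k) %/ m == s)%N & tau x == a]|.

(** For blocks of equal size this is the mean, over the blocks, of the sum of the squared type
    frequencies. *)
Definition spread (k : nat) : R :=
  \sum_(s < k) \sum_(a : 'I_t) k%:R * (block_count k s a)%:R ^+ 2 / m%:R ^+ 2.

Lemma block_count_sum k s :
  (\sum_a block_count k s a = #|[set x : 'I_m | ((x * k) %/ m == s)%N]|)%N.
Proof.
rewrite -[RHS]sum1_card (partition_big tau xpredT) //=; apply: eq_bigr => a _.
by rewrite /block_count -sum1_card; apply: eq_bigl => x; rewrite !inE.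
Qed.

Lemma spread_ge0 k : 0 <= spread k.
Proof.
by rewrite sumr_ge0 // => s _; rewrite sumr_ge0 // => a _; rewrite !mulr_ge0 ?invr_ge0 ?exprn_ge0.
Qed.

Lemma block_sum k : (0 < k)%N ->
  (\sum_(s < k) #|[set x : 'I_m | ((x * k) %/ m == s)%N]| = m)%N.
Proof.
move=> k0; rewrite -[RHS]card_ord -[RHS]sum1_card.
have lt (x : 'I_m) : ((x * k) %/ m < k)%N.
  by rewrite ltn_divLR ?(leq_ltn_trans (leq0n x)) // mulnC ltn_mul2l ltn_ord k0.
rewrite (partition_big (fun x => Ordinal (lt x)) xpredT) //=; apply: eq_bigr => s _.
by rewrite -sum1_card; apply: eq_bigl => x; rewrite inE -(val_eqE (Ordinal (lt x))).
Qed.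

Lemma spread_le2 k : (0 < k)%N -> (k <= m)%N -> spread k <= 2.
Proof.
move=> k0 km; have m0 : (0 < m)%N by exact: leq_trans km.
have m0' : 0 < m%:R :> R by rewrite ltr0n.
pose B (s : nat) : R := #|[set x : 'I_m | ((x * k) %/ m == s)%N]|%:R.
have B2 s : k%:R * B s <= 2 * m%:R.
  by rewrite -!natrM ler_nat mulnC; exact: interval_upper.
have Bsum : \sum_(s < k) B s = m%:R by rewrite -natr_sum block_sum.
have E (s : 'I_k) : \sum_(a : 'I_t) k%:R * (block_count k s a)%:R ^+ 2 / m%:R ^+ 2
    <= 2 / m%:R * B s.
  apply: (@le_trans _ _ (\sum_a (2 / m%:R) * (block_count k s a)%:R)); last first.
    by rewrite -mulr_sumr -natr_sum block_count_sum.
  apply: ler_sum => a _; rewrite ler_pdivrMr ?exprn_gt0 //.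
  have b0 : 0 <= (block_count k s a)%:R :> R by [].
  have bB : (block_count k s a)%:R <= B s.
    by rewrite ler_nat -block_count_sum (bigD1 a) //= leq_addr.
  have H : k%:R * (block_count k s a)%:R <= 2 * m%:R :> R.
    by apply: le_trans (B2 s); rewrite ler_wpM2l.
  have -> : 2 / m%:R * (block_count k s a)%:R * m%:R ^+ 2 = (2 * m%:R) * (block_count k s a)%:R :> R.
    by rewrite expr2; field; rewrite gt_eqF.
  by rewrite expr2 mulrA ler_wpM2r.
apply: le_trans (ler_sum _ (fun s _ => E s)) _.
by rewrite -mulr_sumr Bsum mulfVK // gt_eqF.
Qed.

Lemma block_count_split u c s a : (0 < c)%N -> 
  (\sum_(j < c) block_count (u * c) (s * c + j) a = block_count u s a)%N.
Proof.
move=> c0; rewrite /block_count -[RHS]sum1_card.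
have lt (x : 'I_m) : (((x * (u * c)) %/ m) %% c < c)%N by rewrite ltn_mod.
rewrite (partition_big (fun x => Ordinal (lt x)) xpredT) //=; apply: eq_bigr => j _.
rewrite -sum1_card; apply: eq_bigl => x; rewrite !inE -(val_eqE (Ordinal (lt x))) /=.
(* Blocks are unions of sub-blocks because rounding down composes. *)
have -> : ((x * u) %/ m = (x * (u * c)) %/ m %/ c)%N by rewrite mulnA -divnMA divnMr.
set q := (_ %/ m)%N; rewrite andbAC; congr (_ && _).
apply/eqP/andP => [e|[/eqP e1 /eqP e2]]; last by rewrite (divn_eq q c) e1 e2.
by rewrite e divnMDl // divn_small // addn0 modnMDl modn_small.
Qed.

(** The counts in the [c] sub-blocks have mean [I / c], so refining adds exactly their variance. *)
Lemma spread_increment u c : (0 < u)%N -> (0 < c)%N -> (0 < m)%N ->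
  \sum_(s < u) \sum_(j < c) \sum_(a : 'I_t) (u * c)%:R / m%:R ^+ 2 *
    ((block_count (u * c) (s * c + j) a)%:R - (block_count u s a)%:R / c%:R) ^+ 2
  = spread (u * c) - spread u.
Proof.
move=> u0 c0 m0; rewrite /spread (sum_grid u c (fun s => \sum_(a : 'I_t)
  (u * c)%:R * (block_count (u * c) s a)%:R ^+ 2 / m%:R ^+ 2)) -sumrB; apply: eq_bigr => s _.
rewrite exchange_big [X in X - _]exchange_big -sumrB; apply: eq_bigr => a _ /=.
have cN : c%:R != 0 :> R by rewrite pnatr_eq0 -lt0n.
have mN : m%:R != 0 :> R by rewrite pnatr_eq0 -lt0n.
pose y (j : 'I_c) : R := (block_count (u * c) (s * c + j) a)%:R.
have sy : \sum_j y j = (block_count u s a)%:R by rewrite -(block_count_split u s a c0) natr_sum.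
set I : R := (block_count u s a)%:R in sy *.
transitivity ((u * c)%:R / m%:R ^+ 2 * (\sum_j y j ^+ 2 - 2 * (I / c%:R) * \sum_j y j
    + \sum_(j < c) (I / c%:R) ^+ 2)).
  rewrite [X in _ - X + _]mulr_sumr -sumrB -big_split mulr_sumr /=.
  by apply: eq_bigr => j _; rewrite /y; ring.
rewrite sy sumr_const card_ord -[_ *+ c]mulr_natl.
rewrite [X in _ = X - _](eq_bigr (fun j => (u * c)%:R / m%:R ^+ 2 * y j ^+ 2)); last first.
  by move=> j _; rewrite /y; ring.
rewrite -mulr_sumr natrM; field.
by rewrite mN cN.
Qed.

(** Each deviation is bounded by AM-GM through its square; [eta] balances the number of terms
    against the energy gain. *)
Lemma equidistributed (u c : nat) (eta : R) : (0 < u)%N -> (0 < c)%N -> (0 < m)%N -> 0 < eta ->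
  \sum_(s < u) \sum_(j < c) \sum_(a : 'I_t)
    `|(block_count (u * c) (s * c + j) a)%:R - (block_count u s a)%:R / c%:R|
  <= (t%:R * eta + (spread (u * c) - spread u) / eta) * m%:R.
Proof.
move=> u0 c0 m0 eta0.
have K0 : 0 < (u * c)%:R :> R by rewrite ltr0n muln_gt0 u0.
have m0' : 0 < m%:R :> R by rewrite ltr0n.
have amgm (x : R) : `|x| <= (eta / (u * c)%:R + (u * c)%:R / m%:R ^+ 2 * x ^+ 2 / eta) * m%:R.
  pose z := `|x| / m%:R.
  have -> : (u * c)%:R / m%:R ^+ 2 * x ^+ 2 / eta = (u * c)%:R / eta * z ^+ 2.
    by rewrite /z expr_div_n real_normK ?num_real //; ring.
  rewrite -ler_pdivrMr // -/z.
  move: (u * c)%:R K0 => k K0.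
  have -> : eta / k + k / eta * z ^+ 2 = z + ((eta - k * z) ^+ 2 + k * eta * z) / (k * eta).
    by field; rewrite (gt_eqF eta0) (gt_eqF K0).
  have z0 : 0 <= z by rewrite divr_ge0 // ltW.
  rewrite lerDl; apply: divr_ge0; last by rewrite mulr_ge0 // ltW.
  by apply: addr_ge0; [exact: sqr_ge0|rewrite mulr_ge0 // mulr_ge0 // ltW].
rewrite -spread_increment //.
apply: (@le_trans _ _ (\sum_(s < u) \sum_(j < c) \sum_(a : 'I_t)
   ((eta / (u * c)%:R + (u * c)%:R / m%:R ^+ 2 *
     ((block_count (u * c) (s * c + j) a)%:R - (block_count u s a)%:R / c%:R) ^+ 2 / eta) * m%:R))).
  by apply: ler_sum => s _; apply: ler_sum => j _; apply: ler_sum => a _; exact: amgm.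
have -> : t%:R * eta = \sum_(s < u) \sum_(j < c) \sum_(a < t) eta / (u * c)%:R.
  rewrite !sumr_const !card_ord -!mulrnA -[RHS]mulr_natl !natrM.
  by field; rewrite !pnatr_eq0 -!lt0n u0 c0.
rewrite mulr_suml -big_split mulr_suml; apply: ler_sum => s _ /=.
rewrite mulr_suml -big_split mulr_suml; apply: ler_sum => j _ /=.
by rewrite mulr_suml -big_split mulr_suml; apply: ler_sum => a _ /=.
Qed.

End Equidistribution.

(** * Systems of representatives for a large dimension *)

Section IntervalSystem.
Variables (R : realType) (m t u c : nat) (tau : 'I_m -> 'I_t) (beta : R).
Hypotheses (u0 : (0 < u)%N) (c0 : (0 < c)%N) (ucm : (u * c <= m)%N) (b0 : 0 < beta) (b1 : beta <= 1).

Let K0 : (0 < u * c)%N. Proof. by rewrite muln_gt0 u0. Qed.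
Let m0 : (0 < m)%N. Proof. exact: leq_trans ucm. Qed.
Let m0R : 0 < m%:R :> R. Proof. by rewrite ltr0n. Qed.
Let K0R : 0 < (u * c)%:R :> R. Proof. by rewrite ltr0n. Qed.
Let c0R : 0 < c%:R :> R. Proof. by rewrite ltr0n. Qed.

Definition sub_block (s : 'I_u) (j : 'I_c) : {set 'I_m} :=
  [set x : 'I_m | ((x * (u * c)) %/ m == s * c + j)%N].

Definition type_block (s : 'I_u) (j : 'I_c) (a : 'I_t) : {set 'I_m} :=
  [set x : 'I_m | ((x * (u * c)) %/ m == s * c + j)%N & tau x == a].

(* A type that is rare in the sub-block is represented by arbitrary rows of the
   sub-block, which keeps the density of the representatives bounded. *)
Definition rep_block (s : 'I_u) (j : 'I_c) (a : 'I_t) : {set 'I_m} :=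
  if beta * m%:R / (u * c)%:R <= #|type_block s j a|%:R then type_block s j a
  else sub_block s j.

Lemma rep_block_sub s j a : rep_block s j a \subset sub_block s j.
Proof. by rewrite /rep_block; case: ifP => // _; apply/subsetP => x; rewrite !inE => /andP []. Qed.

Lemma rep_block_large s j a : beta * m%:R / (2 * (u * c)%:R) <= #|rep_block s j a|%:R.
Proof.
have half : beta * m%:R / (2 * (u * c)%:R) <= beta * m%:R / (u * c)%:R.
  rewrite ler_wpM2l ?mulr_ge0 ?(ltW b0) // lef_pV2 ?posrE ?mulr_gt0 //.
  by move: K0R; lra.
rewrite /rep_block; case: ifP => [|_]; first exact: le_trans.
have lt : (s * c + j < u * c)%N.
  have : (s.+1 * c <= u * c)%N by rewrite leq_mul2r ltn_ord orbT.
  by rewrite mulSn; have := ltn_ord j; lia.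
have low : (m <= 2 * (#|sub_block s j| * (u * c)))%N by exact: interval_lower.
rewrite ler_pdivrMr ?mulr_gt0 //.
apply: (@le_trans _ _ m%:R); first by rewrite ler_piMl // ltW.
by move: low; rewrite -(ler_nat R) !natrM mulrCA.
Qed.

Lemma rep_block_gt0 s j a : 0 < #|rep_block s j a|%:R :> R.
Proof. by apply: lt_le_trans (rep_block_large s j a); rewrite divr_gt0 ?mulr_gt0. Qed.

Let weight (j : 'I_c) (sa : 'I_u * 'I_t) (x : 'I_m) : R :=
  (x \in rep_block sa.1 j sa.2)%:R / #|rep_block sa.1 j sa.2|%:R.

Let weight_ge0 j sa x : 0 <= weight j sa x. Proof. by rewrite divr_ge0. Qed.

Let weight_sum j sa : \sum_x weight j sa x = 1.
Proof.
rewrite -mulr_suml -natr_sum -big_mkcond /= sum1_card divff // gt_eqF //.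
exact: rep_block_gt0.
Qed.

(** One index [j] shared by all cells and, given [j], an independent uniform element of each
    representing set in the [j]-th sub-blocks. *)
Let space := ('I_c * {ffun 'I_u * 'I_t -> 'I_m})%type.
Let mu (w : space) : R := c%:R^-1 * \prod_sa weight w.1 sa (w.2 sa).

Let mu_marginal sa (phi : 'I_c -> 'I_m -> R) :
  \sum_w mu w * phi w.1 (w.2 sa) = \sum_j c%:R^-1 * \sum_x weight j sa x * phi j x.
Proof.
rewrite -(pair_big xpredT xpredT (fun j f => mu (j, f) * phi j (f sa))) /=.
apply: eq_bigr => j _; rewrite -(ffun_marginal _ _ (weight_sum j)) mulr_sumr.
by apply: eq_bigr => f _; rewrite /mu mulrA.
Qed.

Let mu_sum_time (h : 'I_c -> R) : \sum_w mu w * h w.1 = \sum_j c%:R^-1 * h j.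
Proof.
rewrite -(pair_big xpredT xpredT (fun j f => mu (j, f) * h j)) /=.
apply: eq_bigr => j _; rewrite -mulr_suml /mu -mulr_sumr /= sum_ffun_prod.
by rewrite big1 ?mulr1.
Qed.

Let slot_lt (x : 'I_m) : ((x * u) %/ m < u)%N.
Proof. by rewrite ltn_divLR // mulnC ltn_mul2l ltn_ord u0. Qed.

(** The first term pays for types rare in a sub-block, the second for sub-blocks whose types are
    distributed unlike the block. *)
Let err := t%:R * beta + (\sum_(s < u) \sum_(j < c) \sum_(a : 'I_t)
  `|(block_count tau (u * c) (s * c + j) a)%:R - (block_count tau u s a)%:R / c%:R|) / m%:R.

(** Both sides are compared for each block, sub-block and type. A common type is represented by its
    own rows, so only the deviation [|nJ - nI|] is paid; a rare one costs at most [nI], which is at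
    most the threshold plus that deviation. *)
Let rep_near (psi : 'I_t -> 'I_m -> R) : (forall a x, 0 <= psi a x <= 1) ->
  \sum_x \sum_w mu w * psi (tau x) (w.2 (Ordinal (slot_lt x), tau x))
    <= \sum_x psi (tau x) x + err * m%:R.
Proof.
move=> psi01.
have psi0 a x : 0 <= psi a x by case/andP: (psi01 a x).
have psi1 a x : psi a x <= 1 by case/andP: (psi01 a x).
pose avg s j a := \sum_x weight j (s, a) x * psi a x.
have avg0 s j a : 0 <= avg s j a by rewrite sumr_ge0 // => x _; rewrite mulr_ge0.
have avg1 s j a : avg s j a <= 1.
  by rewrite -(weight_sum j (s, a)); apply: ler_sum => x _; rewrite ler_piMr.
have -> : \sum_x \sum_w mu w * psi (tau x) (w.2 (Ordinal (slot_lt x), tau x)) =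
    \sum_(s < u) \sum_(j < c) \sum_(a : 'I_t) (block_count tau u s a)%:R / c%:R * avg s j a.
  under eq_bigr => x _ do rewrite (mu_marginal _ (fun _ => psi (tau x))).
  rewrite (partition_big (fun x => Ordinal (slot_lt x)) xpredT) //=; apply: eq_bigr => s _.
  rewrite (partition_big tau xpredT) //= [RHS]exchange_big; apply: eq_bigr => a _ /=.
  rewrite (eq_bigr (fun=> \sum_j c%:R^-1 * avg s j a)); last first.
    by move=> x /andP [/eqP -> /eqP ->].
  rewrite sumr_const -[LHS]mulr_natl mulr_sumr; apply: eq_bigr => j _.
  rewrite mulrA; congr (_%:R / _ * _); apply: eq_card => x.
  by rewrite !inE.
have -> : \sum_x psi (tau x) x = \sum_(s < u) \sum_(j < c) \sum_(a : 'I_t)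
    \sum_(x in type_block s j a) psi a x.
  have lt (x : 'I_m) : (((x * (u * c)) %/ m) %% c < c)%N by rewrite ltn_mod.
  have lt' (x : 'I_m) : (((x * (u * c)) %/ m) %/ c < u)%N.
    by rewrite ltn_divLR // ltn_divLR // mulnC ltn_mul2l ltn_ord K0.
  rewrite (partition_big (fun x => Ordinal (lt' x)) xpredT) //=; apply: eq_bigr => s _.
  rewrite (partition_big (fun x => Ordinal (lt x)) xpredT) //=; apply: eq_bigr => j _.
  rewrite (partition_big tau xpredT) //=; apply: eq_bigr => a _.
  apply: eq_big => [x|x /andP [_ /eqP ->] //].
  rewrite !inE -(val_eqE (Ordinal (lt x))) -(val_eqE (Ordinal (lt' x))) /=; congr (_ && _).
  set q := (_ %/ m)%N.
  apply/andP/eqP => [[/eqP e1 /eqP e2]|e]; first by rewrite (divn_eq q c) e1 e2.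
  by rewrite e divnMDl // divn_small // addn0 modnMDl modn_small.
have -> : err * m%:R = \sum_(s < u) \sum_(j < c) \sum_(a : 'I_t) (beta * m%:R / (u * c)%:R +
   `|(block_count tau (u * c) (s * c + j) a)%:R - (block_count tau u s a)%:R / c%:R|).
  under [RHS]eq_bigr do under eq_bigr do rewrite big_split /=.
  under [RHS]eq_bigr do rewrite big_split /=.
  rewrite big_split /= /err mulrDl mulfVK ?gt_eqF //; congr (_ + _).
  rewrite !sumr_const !card_ord -!mulrnA -[RHS]mulr_natl !natrM.
  by field; rewrite !pnatr_eq0 -!lt0n u0 c0.
rewrite -big_split; apply: ler_sum => s _ /=.
rewrite -big_split; apply: ler_sum => j _ /=.
rewrite -big_split; apply: ler_sum => a _ /=.
set nI : R := (block_count tau u s a)%:R / c%:R.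
have nJE : block_count tau (u * c) (s * c + j) a = #|type_block s j a| by [].
rewrite nJE; set nJ : R := #|type_block s j a|%:R.
have nI0 : 0 <= nI by rewrite divr_ge0.
have nJ0 : 0 <= nJ by [].
have small0 : 0 <= beta * m%:R / (u * c)%:R by rewrite divr_ge0 // mulr_ge0 // ltW.
have sum0 : 0 <= \sum_(x in type_block s j a) psi a x by rewrite sumr_ge0.
have diff : nI <= nJ + `|nJ - nI|.
  by have := ler_norm (- (nJ - nI)); rewrite normrN; lra.
have /andP [a0 a1] : 0 <= avg s j a <= 1 by rewrite avg0 avg1.
have abs0 : 0 <= `|nJ - nI| by [].
case: (lerP (beta * m%:R / (u * c)%:R) nJ) => big.
  have avgE : nJ * avg s j a = \sum_(x in type_block s j a) psi a x.
    have e : rep_block s j a = type_block s j a by rewrite /rep_block big.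
    have nJ_gt : 0 < nJ by apply: lt_le_trans big; rewrite divr_gt0 ?mulr_gt0.
    rewrite /avg mulr_sumr [RHS]big_mkcond; apply: eq_bigr => x _.
    rewrite /weight /= e -/nJ mulrA mulrCA divff ?gt_eqF // mulr1.
    by case: (_ \in _); rewrite ?mul1r ?mul0r.
  rewrite -avgE; nra.
by nra.
Qed.

Lemma interval_system : rep_system false u c tau (2 * (u * c)%:R / beta) err.
Proof.
refine (@RepSystem R false m u t c tau _ _ (fun x => Ordinal (slot_lt x)) space mu
  (fun w => w.2) (fun w => w.1) _ _ _ _ _ _ _).
- by move=> x y xy /=; rewrite leq_div2r // leq_mul2r (ltnW xy) orbT.
- by move=> w; rewrite mulr_ge0 ?invr_ge0 ?prodr_ge0.
- rewrite (eq_bigr (fun w => mu w * 1)) => [|w _]; last by rewrite mulr1.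
  by rewrite (mu_sum_time (fun=> 1)) -mulr_sumr sumr_const card_ord mulVf // gt_eqF.
- move=> j; rewrite (_ : c%:R^-1 = \sum_i c%:R^-1 * (i == j)%:R); last first.
    by rewrite (bigD1 j) //= eqxx mulr1 big1 ?addr0 // => i /negPf ->; rewrite mulr0.
  rewrite -(mu_sum_time (fun i => (i == j)%:R)) big_mkcond; apply: ler_sum => w _.
  by case: eqP; rewrite ?mulr1 ?mulr0.
(* Increasing times put the two rows into sub-blocks with strictly increasing numbers [s c + j],
   even if their blocks coincide. *)
- move=> w w' a a' w0 w0'; rewrite /slot_rel => le lt.
  have inJ (v : space) sa : 0 < mu v -> v.2 sa \in sub_block sa.1 v.1.
    move=> v0; apply: (subsetP (rep_block_sub sa.1 v.1 sa.2)); apply: contraTT v0 => out.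
    by rewrite /mu (bigD1 sa) //= /weight (negPf out) !mul0r mulr0 ltxx.
  have := inJ _ a w0; have := inJ _ a' w0'; rewrite !inE => /eqP e' /eqP e.
  rewrite ltnNge; apply/negP => ge.
  have : ((w'.2 a' * (u * c)) %/ m <= (w.2 a * (u * c)) %/ m)%N.
    by rewrite leq_div2r // leq_mul2r ge orbT.
  rewrite e e'; have : (a.1 * c <= a'.1 * c)%N by rewrite leq_mul2r le orbT.
  by move: lt => /=; move: (a.1 * c)%N (a'.1 * c)%N => A B; lia.
- move=> sa z.
  have -> : \sum_(w : space | w.2 sa == z) mu w = \sum_j c%:R^-1 * \sum_x weight j sa x * (x == z)%:R.
    rewrite -(mu_marginal sa (fun _ x => (x == z)%:R)) big_mkcond; apply: eq_bigr => w _.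
    by case: eqP; rewrite ?mulr1 ?mulr0.
  apply: (@le_trans _ _ (\sum_(j < c) c%:R^-1 * (2 * (u * c)%:R / beta / m%:R))); last first.
    by rewrite -mulr_suml sumr_const card_ord -[_ *+ c]mulr_natl divff ?mul1r // gt_eqF.
  apply: ler_sum => j _; rewrite ler_wpM2l ?invr_ge0 //.
  rewrite (bigD1 z) //= eqxx mulr1 big1 ?addr0; last by move=> x /negPf ->; rewrite mulr0.
  apply: (@le_trans _ _ (#|rep_block sa.1 j sa.2|%:R^-1)).
    by rewrite /weight ler_piMl ?invr_ge0 // lern1 leq_b1.
  rewrite -[leRHS]invrK lef_pV2 ?posrE ?rep_block_gt0 //; last first.
    by rewrite invr_gt0 !divr_gt0 ?mulr_gt0.
  apply: le_trans (rep_block_large _ _ _).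
  rewrite le_eqVlt; apply/orP; left; apply/eqP.
  by rewrite !invfM !invrK; ring.
- exact: rep_near.
Qed.

End IntervalSystem.

(** * Choice of scales and parameters *)

Lemma weaken_system (R : realType) (b : bool) (m u t c : nat) (tau : 'I_m -> 'I_t) (D e D' e' : R) :
  D <= D' -> e <= e' -> rep_system b u c tau D e -> rep_system b u c tau D' e'.
Proof.
move=> DD ee S.
refine (@RepSystem R b m u t c tau D' e' (rs_slot S) (rs_space S) (rs_mu S) (rs_row S)
  (rs_time S) (rs_slot_mono S) (rs_mu_ge0 S) (rs_mu_sum S) (rs_time_le S) (rs_order S) _ _).
- by move=> a z; apply: le_trans (rs_row_le S a z) _; rewrite ler_wpM2r // invr_ge0.
- by move=> psi psi01; apply: le_trans (rs_near S psi psi01) _; rewrite lerD2l ler_wpM2r.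
Qed.

(* [None]: the dimension is large; [Some k]: the dimension is k + 1, and every
   line is a slot of its own. *)
Definition in_mode (o : option nat) (N m : nat) : Prop :=
  if o is Some k then m = k else (N <= m)%N.

Definition slots (o : option nat) (u : nat) : nat := if o is Some k then k.+1 else u.

Lemma in_mode_mono o N N' m : (N <= N')%N -> in_mode o N' m -> in_mode o N m.
Proof. by case: o => //= le; exact: leq_trans. Qed.

(** Zero for a bounded dimension, where the representatives are exact at every scale. *)
Definition spread_of (R : realType) (o : option nat) (m t : nat) (tau : 'I_m -> 'I_t) (u : nat) : R :=
  if o is Some _ then 0 else spread R tau u.

(** For a large dimension [equidistributed] is used with [eta] equal to [beta]: the terms [t * beta]
    take one half of [e0], the energy gain the other. *)
Lemma mode_system (R : realType) (o : option nat) (m t u c : nat) (tau : 'I_m.+1 -> 'I_t)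
    (beta e0 D : R) :
  (0 < u)%N -> (0 < c)%N -> in_mode o (u * c) m -> 0 < beta -> beta <= 1 ->
  t%:R * (beta + beta) <= e0 / 2 ->
  spread_of R o tau (u * c) - spread_of R o tau u <= beta * (e0 / 2) ->
  0 <= e0 -> 2 * (u * c)%:R / beta <= D -> (odflt 0%N o).+1%:R <= D ->
  rep_system (isSome o) (slots o u) c tau D e0.
Proof.
move=> u0 c0; case: o => [k|] /= om beta0 beta1 tb sp e00 D1 D2.
  have S : rep_system true m.+1 c tau D 0 by apply: discrete_system; rewrite // om.
  by rewrite -om; exact: weaken_system S.
have ucm : (u * c <= m.+1)%N by exact: leqW.
apply: weaken_system D1 _ (interval_system tau u0 c0 ucm beta0 beta1).
have m0 : 0 < m.+1%:R :> R by [].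
have := equidistributed tau u0 c0 (ltn0Sn m) beta0.
rewrite -ler_pdivrMr // => H.
have : (spread R tau (u * c) - spread R tau u) / beta <= e0 / 2 by rewrite ler_pdivrMr // mulrC.
move: H tb; move: (_ / m.+1%:R) (_ / beta) => TV X; lra.
Qed.

Lemma cut_close_mono (R : realType) (Sigma X Y : finType) (M : X -> Y -> Sigma) (th th' : R) W :
  th <= th' -> cut_close M th W -> cut_close M th' W.
Proof.
move=> le H s U V; apply: le_trans (H s U V) _.
by rewrite -!mulrA ler_wpM2r ?mulr_ge0.
Qed.

Definition close_data (R : realType) (Sigma : finType) (th d : R) (m n t : nat)
    (M : 'M[Sigma]_(m.+1, n.+1)) (tau1 : 'I_m.+1 -> 'I_t) (tau2 : 'I_n.+1 -> 'I_t) : Prop :=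
  exists (W : Sigma -> 'I_m.+1 * 'I_n.+1 -> R) (g : Sigma -> 'I_t -> 'I_t -> R),
  [/\ forall s w, 0 <= W s w <= 1, forall x, \sum_s W s x = 1,
    forall s a a', 0 <= g s a a' <= 1, cut_close (fun x y => M x y) th W
    & \sum_s \sum_x \sum_y `|W s (x, y) - g s (tau1 x) (tau2 y)| <= d * m.+1%:R * n.+1%:R].

Lemma increasing_step (R : realType) (f : nat -> R) (L : nat) (w b : R) :
  b < L%:R * w -> 0 <= f 0%N -> f L <= b -> exists i, (i < L)%N /\ f i.+1 - f i <= w.
Proof.
move=> bL f0 fL; apply: contrapT => none.
suff : forall i, (i <= L)%N -> i%:R * w <= f i.
  by move=> /(_ L (leqnn L)); move: bL fL; lra.
elim=> [|i IH] iL; first by rewrite mul0r.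
rewrite leNgt; apply/negP => lt; apply: none; exists i; split=> //.
by have := IH (ltnW iL); move: lt; rewrite -natr1; lra.
Qed.

(** The number of sub-blocks needed depends on the number of blocks, so scales [us i] are built by
    iteration. The energies of rows and columns sum to at most [4], hence some early step raises
    both little, giving one scale for both dimensions. It depends on the matrix, but only [L] scales
    are possible. *)
Lemma fixed_types (R : realType) (Sigma : finType) (P : mxproperty Sigma) (o1 o2 : option nat)
    (t : nat) (eps : R) : 0 < eps ->
  exists N : nat, forall (m n : nat) (M : 'M[Sigma]_(m.+1, n.+1))
    (tau1 : 'I_m.+1 -> 'I_t) (tau2 : 'I_n.+1 -> 'I_t),
  in_mode o1 N m -> in_mode o2 N n -> close_data (N.+1%:R^-1) (eps / 32) M tau1 tau2 ->
  far P eps M -> detects P N M.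
Proof.
move=> eps0.
pose a : R := #|Sigma|%:R + 1.
have S0 : 0 <= #|Sigma|%:R :> R by [].
have a1 : 1 <= a by rewrite /a; lra.
have a0 : 0 < a by lra.
(* Of the budget [eps / 4], at most [eps / 16] goes to [d + d], [eps / 8] to the two errors [e0] and
   [eps / 32] to [gam]. The first bound makes [gam] smaller than [1 / #|Sigma|]. *)
pose gam : R := Num.min (1 / (2 * a)) (eps / (32 * a)).
have gam0 : 0 < gam by rewrite lt_min !divr_gt0 ?mulr_gt0.
have gamA : a * gam <= 1 / 2.
  apply: (@le_trans _ _ (a * (1 / (2 * a)))); first by rewrite ler_pM2l // ge_min lexx.
  by rewrite le_eqVlt; apply/orP; left; apply/eqP; field; rewrite gt_eqF.
have gamE : a * gam <= eps / 32.
  apply: (@le_trans _ _ (a * (eps / (32 * a)))); first by rewrite ler_pM2l // ge_min lexx orbT.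
  by rewrite le_eqVlt; apply/orP; left; apply/eqP; field; rewrite gt_eqF.
have gam1 : gam <= 1 by nra.
have gamS : #|Sigma|%:R * gam < 1 by move: gamA; rewrite /a; lra.
pose e0 : R := eps / (16 * a).
have e00 : 0 < e0 by rewrite divr_gt0 ?mulr_gt0.
have ae0 : a * e0 = eps / 16 by rewrite /e0; field; rewrite gt_eqF.
pose beta : R := Num.min 1 (e0 / (4 * (t%:R + 1))).
have t0 : 0 <= t%:R :> R by [].
have t10 : 0 < t%:R + 1 :> R by lra.
have beta0 : 0 < beta by rewrite lt_min ltr01 /= divr_gt0 // mulr_gt0.
have beta1 : beta <= 1 by rewrite ge_min lexx.
have beta_t : t%:R * (beta + beta) <= e0 / 2.
  have : beta <= e0 / (4 * (t%:R + 1)) by rewrite ge_min lexx orbT.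
  by rewrite ler_pdivlMr ?mulr_gt0 // => ?; nra.
pose w : R := beta * (e0 / 2).
have w0 : 0 < w by rewrite mulr_gt0 // divr_gt0.
have /choice [c0 Hc0] := fun u : nat =>
  core_detection P (isSome o1) (isSome o2) (slots o1 u) (slots o2 u) t gam0 gam1 gamS eps0.
pose c u := (c0 u).+1.
pose us i := iter i (fun u => u * c u)%N 1%N.
have us_gt0 i : (0 < us i)%N by elim: i => [|i IH] //; rewrite /= muln_gt0; apply/andP.
have us_mono i j : (i <= j)%N -> (us i <= us j)%N.
  by move/subnK <-; elim: (j - i)%N => //= d IH; apply: leq_trans IH _; rewrite leq_pmulr.
pose D u : R := 2 * (u * c u)%:R / beta + (odflt 0%N o1).+1%:R + (odflt 0%N o2).+1%:R.
have Dpos u : 0 <= 2 * (u * c u)%:R / beta by rewrite divr_ge0 ?mulr_ge0 // ltW.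
have D1 u : 1 <= D u.
  rewrite /D; have := Dpos u; have : 1 <= (odflt 0%N o1).+1%:R :> R by rewrite ler1n.
  by have : 0 <= (odflt 0%N o2).+1%:R :> R by []; lra.
pose L := Num.bound (5 / w).
have Lw : 4 < L%:R * w.
  have : 5 / w < L%:R by rewrite archi_boundP // divr_ge0 // ltW.
  by rewrite ltr_pdivrMr //; lra.
(* Using [N.+1%:R^-1] as accuracy makes the claim monotone in [N], so one [N] serves all scales. *)
have [N HN] : exists N, forall i : 'I_L, forall (m n : nat) (M : 'M[Sigma]_(m.+1, n.+1))
    (tau1 : 'I_m.+1 -> 'I_t) (tau2 : 'I_n.+1 -> 'I_t)
    (S1 : rep_system (isSome o1) (slots o1 (us i)) (c (us i)) tau1 (D (us i)) e0)
    (S2 : rep_system (isSome o2) (slots o2 (us i)) (c (us i)) tau2 (D (us i)) e0),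
    close_data (N.+1%:R^-1) (eps / 32) M tau1 tau2 -> far P eps M -> detects P N M.
  apply: uniform_bound => [i k l kl H m n M tau1 tau2 S1 S2 [W [g [W01 W1 g01 cut L1]]] farM|i].
    apply: (detects_mono kl); apply: (H m n M tau1 tau2 S1 S2) => //.
    exists W, g; split=> //; apply: cut_close_mono cut.
    by rewrite lef_pV2 ?posrE // ler_nat ltnS.
  have [th [th0 [N HN]]] := Hc0 (us i) (c (us i)) (c (us i)) (leqnSn _) (leqnSn _) (D (us i)) (D1 _).
  exists (maxn N (Num.bound th^-1)) => m n M tau1 tau2 S1 S2 [W [g [W01 W1 g01 cut L1]]] farM.
  apply: detects_mono (leq_maxl _ _) _.
  apply: (HN m n M tau1 tau2 e0 e0 (eps / 32) S1 S2 W g) => //.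
    apply: cut_close_mono cut; rewrite -[leRHS]invrK lef_pV2 ?posrE ?invr_gt0 //.
    apply: le_trans (ltW (archi_boundP _)) _; first by rewrite invr_ge0 ltW.
    by rewrite ler_nat; apply: leq_trans (leq_maxr N _) (leqnSn _).
  by move: gamE ae0; rewrite /a; lra.
exists (maxn N (us L)) => m n M tau1 tau2 om1 om2 data farM.
pose tot i := spread_of R o1 tau1 (us i) + spread_of R o2 tau2 (us i).
have sp0 o p (tau : 'I_p.+1 -> 'I_t) u : 0 <= spread_of R o tau u.
  by case: o => //=; exact: spread_ge0.
have sp2 o p (tau : 'I_p.+1 -> 'I_t) : in_mode o (us L) p -> spread_of R o tau (us L) <= 2.
  by case: o => // le; apply: spread_le2; [exact: (us_gt0 L)|exact: (leqW le)].
have sp_incr o p (tau : 'I_p.+1 -> 'I_t) i :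
    spread_of R o tau (us i) <= spread_of R o tau (us i.+1).
  case: o => //=; rewrite -subr_ge0 -spread_increment //.
  rewrite sumr_ge0 // => s _; rewrite sumr_ge0 // => j _; rewrite sumr_ge0 // => x _.
  by rewrite mulr_ge0 ?sqr_ge0 // divr_ge0 // exprn_ge0.
have om1' : in_mode o1 (us L) m by apply: in_mode_mono om1; exact: leq_maxr.
have om2' : in_mode o2 (us L) n by apply: in_mode_mono om2; exact: leq_maxr.
have [i [iL step]] : exists i, (i < L)%N /\ tot i.+1 - tot i <= w.
  apply: (increasing_step Lw); first by rewrite addr_ge0.
  by have := sp2 _ _ tau1 om1'; have := sp2 _ _ tau2 om2'; rewrite /tot; lra.
apply: detects_mono (leq_maxl _ _) _.
have usS : us i.+1 = (us i * c (us i))%N by [].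
have usL : (us i * c (us i) <= us L)%N by exact: (us_mono i.+1).
have i1 := sp_incr o1 _ tau1 i; have i2 := sp_incr o2 _ tau2 i.
have S1 : rep_system (isSome o1) (slots o1 (us i)) (c (us i)) tau1 (D (us i)) e0.
  apply: (mode_system (us_gt0 i) (ltn0Sn _) _ beta0 beta1 beta_t _ (ltW e00)).
  - exact: in_mode_mono om1'.
  - by rewrite -usS; move: step i1 i2; rewrite /tot /w; lra.
  - by rewrite /D -addrA lerDl addr_ge0.
  - rewrite /D; have := Dpos (us i).
    by have : 0 <= (odflt 0%N o2).+1%:R :> R by []; lra.
have S2 : rep_system (isSome o2) (slots o2 (us i)) (c (us i)) tau2 (D (us i)) e0.
  apply: (mode_system (us_gt0 i) (ltn0Sn _) _ beta0 beta1 beta_t _ (ltW e00)).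
  - exact: in_mode_mono om2'.
  - by rewrite -usS; move: step i1 i2; rewrite /tot /w; lra.
  - by rewrite /D -addrA lerDl addr_ge0.
  - rewrite /D; have := Dpos (us i).
    by have : 0 <= (odflt 0%N o1).+1%:R :> R by []; lra.
apply: (HN (Ordinal iL) m n M tau1 tau2 S1 S2) => //.
have [W [g [W01 W1 g01 cut L1]]] := data.
exists W, g; split=> //; apply: cut_close_mono cut.
by rewrite lef_pV2 ?posrE // ler_nat ltnS leq_maxl.
Qed.

(** Strong regularity is run with the accuracy that [fixed_types] demands for [t] types; as [t] is
    at most [T], a maximum over [t] suffices. *)
Lemma mode_detection (R : realType) (Sigma : finType) (P : mxproperty Sigma) (o1 o2 : option nat)
    (eps : R) : 0 < eps ->
  exists N : nat, forall (m n : nat) (M : 'M[Sigma]_(m.+1, n.+1)),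
  in_mode o1 N m -> in_mode o2 N n -> far P eps M -> detects P N M.
Proof.
move=> eps0.
have /choice [N HN] := fun t => fixed_types P o1 o2 t eps0.
pose a : R := #|Sigma|%:R + 1.
have S0 : 0 <= #|Sigma|%:R :> R by [].
have a0 : 0 < a by rewrite /a; lra.
pose k : R := eps / (64 * a).
have k0 : 0 < k by rewrite divr_gt0 ?mulr_gt0.
have ak : a * k = eps / 64 by rewrite /k; field; rewrite gt_eqF.
have e0 : 0 < k * (eps / 64) by rewrite mulr_gt0 // divr_gt0.
have th0 t : 0 < (N t).+1%:R^-1 :> R by rewrite invr_gt0.
have [T HT] := strong_regularity e0 th0.
exists (\max_(t < T.+1) N t)%N => m n M om1 om2 farM.
have [t [tX [tY [tX' [tY' [tT [ltX ltY] [rX rY] cut en]]]]]] := HT _ _ _ (fun x y => M x y).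
have Nt : (N t <= \max_(t < T.+1) N t)%N.
  exact: (leq_bigmax (F := fun t : 'I_T.+1 => N t) (Ordinal (tT : (t < T.+1)%N))).
apply: (detects_mono Nt).
pose tau1 x := Ordinal (ltX x); pose tau2 y := Ordinal (ltY y).
apply: (HN t m n M tau1 tau2) => //; [exact: in_mode_mono Nt om1|exact: in_mode_mono Nt om2|].
pose f := fun x y => M x y.
exists (dens R f tX' tY').
(* The coarse density depends only on the types; pairs of types that do not occur get the default
   [0]. *)
pose g s b b' : R := if [pick z | (tau1 z.1 == b) && (tau2 z.2 == b')] is Some z
  then dens R f tX tY s z else 0.
have gE s x y : g s (tau1 x) (tau2 y) = dens R f tX tY s (x, y).
  rewrite /g; case: pickP => [[x' y'] /= /andP [/eqP [e] /eqP [e']]|/(_ (x, y))]; last by rewrite !eqxx.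
  by apply: cavg_eq; rewrite /lab /= e e'.
exists g; split=> //.
- by move=> s z; rewrite dens_ge0 dens_le1.
- by move=> z; exact: dens_sum.
- by move=> s b b'; rewrite /g; case: pickP => [z _|_]; rewrite ?dens_ge0 ?dens_le1 ?lexx ?ler01.
- have := energy_diff R f rX rY; move: en; rewrite -/f !card_ord => en enE.
  (* From L2 to L1 by [|z| <= z ^+ 2 / k + k]; each of the two sums contributes at most
     [eps / 64]. *)
  apply: (@le_trans _ _ (\sum_s \sum_z ((dens R f tX' tY' s z - dens R f tX tY s z) ^+ 2 / k + k))).
    apply: ler_sum => s _; rewrite pair_big /=; apply: ler_sum => -[x y] _ /=.
    rewrite gE; set z := _ - _; rewrite -(real_normK (num_real z)).
    have : 0 <= (`|z| - k) ^+ 2 / k + `|z| by rewrite addr_ge0 // divr_ge0 ?sqr_ge0 // ltW.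
    have -> : (`|z| - k) ^+ 2 / k = `|z| ^+ 2 / k - 2 * `|z| + k by field; rewrite gt_eqF.
    by lra.
  under eq_bigr do rewrite big_split /= -mulr_suml.
  rewrite big_split /= -mulr_suml enE !sumr_const card_prod !card_ord.
  rewrite -mulrnA -[k *+ _]mulr_natl !natrM.
  have -> : eps / 32 * m.+1%:R * n.+1%:R =
    (k * (eps / 64) * m.+1%:R * n.+1%:R) / k + eps / 64 * (m.+1%:R * n.+1%:R).
    by field; rewrite gt_eqF.
  apply: lerD; first by rewrite ler_wpM2r // invr_ge0 ltW.
  rewrite -ak /a; have : 0 <= m.+1%:R * n.+1%:R * k :> R by apply: mulr_ge0 (ltW k0); rewrite mulr_ge0.
  by lra.
Qed.

(** If a dimension is below [N1], its value is fixed and the other one is compared with a threshold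
    depending on it. When that fails too, both are below [B], and finitely many sizes remain. *)
Lemma detection (R : realType) (Sigma : finType) (P : mxproperty Sigma) (eps : R) : 0 < eps ->
  exists N : nat, forall (m n : nat) (M : 'M[Sigma]_(m.+1, n.+1)), far P eps M -> detects P N M.
Proof.
move=> eps0.
have H o1 o2 := mode_detection P o1 o2 eps0.
have [N1 H1] := H None None.
have /choice [N2 H2] := fun k => H (Some k) None.
have /choice [N3 H3] := fun k => H None (Some k).
have /choice [N4 H4] := fun kl : nat * nat => H (Some kl.1) (Some kl.2).
pose B2 := (\max_(k < N1) N2 k)%N; pose B3 := (\max_(k < N1) N3 k)%N.
pose B := maxn N1 (maxn B2 B3).
pose B4 := (\max_(k < B) \max_(l < B) N4 (k : nat, l : nat))%N.
have dd m n : (m < B)%N -> (n < B)%N -> (N4 (m, n) <= B4)%N.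
  move=> mB nB.
  apply: leq_trans (leq_bigmax (F := fun k : 'I_B => \max_(l < B) N4 (k : nat, l : nat)) (Ordinal mB)).
  exact: (leq_bigmax (F := fun l : 'I_B => N4 (m, l : nat)) (Ordinal nB)).
exists (maxn B B4) => m n M farM.
have case4 : (m < B)%N -> (n < B)%N -> detects P (maxn B B4) M.
  move=> mB nB; apply: (detects_mono (N := N4 (m, n))); last exact: H4.
  by rewrite leq_max (dd m n) // orbT.
case: (leqP N1 m) => mN; case: (leqP N1 n) => nN.
- by apply: (detects_mono (N := N1)); [rewrite !leq_max leqnn|exact: H1].
- have le : (N3 n <= B3)%N by exact: (leq_bigmax (F := fun k : 'I_N1 => N3 k) (Ordinal nN)).
  case: (leqP (N3 n) m) => mN3; last first.
    by apply: case4; rewrite !leq_max ?nN // (leq_trans mN3 le) !orbT.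
  by apply: (detects_mono (N := N3 n)); [rewrite !leq_max le !orbT|exact: (H3 n)].
- have le : (N2 m <= B2)%N by exact: (leq_bigmax (F := fun k : 'I_N1 => N2 k) (Ordinal mN)).
  case: (leqP (N2 m) n) => nN2; last first.
    by apply: case4; rewrite !leq_max ?mN // (leq_trans nN2 le) !orbT.
  by apply: (detects_mono (N := N2 m)); [rewrite !leq_max le !orbT|exact: (H2 m)].
- by apply: case4; rewrite !leq_max ?mN ?nN.
Qed.

(** * The tester: repeated sampling *)

Section Trials.
Variables (R : realType) (Sigma : finType) (P : mxproperty Sigma) (s0 : Sigma) (m n : nat).
Implicit Types (M A : 'M[Sigma]_(m.+1, n.+1)).

(** [Draw] ranges over ['I_k.+1]; the point [x0] makes [T] nonempty, so its cardinal has this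
    form. *)
Definition draw_from (T : finType) (x0 : T) (K : T -> algorithm Sigma m.+1 n.+1) :
    algorithm Sigma m.+1 n.+1 :=
  Draw (fun s : 'I_(#|T|.-1).+1 => K (nth x0 (enum T) s)).

Lemma prob_draw_from (T : finType) (x0 : T) K M b :
  prob_answer R M b (draw_from x0 K) = (\sum_x prob_answer R M b (K x)) / #|T|%:R.
Proof.
have T0 : (0 < #|T|)%N by apply/card_gt0P; exists x0.
rewrite /= -(big_mkord xpredT (fun i => prob_answer R M b (K (nth x0 (enum T) i)))) prednK //.
by rewrite -[in RHS]big_enum /= (big_nth x0) -cardE.
Qed.

Lemma queries_draw_from (T : finType) (x0 : T) K q :
  (forall x, num_queries (K x) <= q)%N -> (num_queries (draw_from x0 K) <= q)%N.
Proof. by move=> H; apply/bigmax_leqP => s _; exact: H. Qed.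

(** Answers are stored in an accumulator matrix, on which the decision is then taken. *)
Fixpoint read_all (s : seq ('I_m.+1 * 'I_n.+1)) (K : 'M[Sigma]_(m.+1, n.+1) -> algorithm Sigma m.+1 n.+1)
    (A : 'M[Sigma]_(m.+1, n.+1)) : algorithm Sigma m.+1 n.+1 :=
  if s is e :: s' then Query e.1 e.2 (fun c =>
    read_all s' K (\matrix_(i, j) if (i, j) == e then c else A i j))
  else K A.

(** The alternative [A i j = M i j] carries the induction: entries already recorded stay correct. *)
Lemma prob_read_all s K M b A : exists A',
  prob_answer R M b (read_all s K A) = prob_answer R M b (K A') /\
  (forall i j, (i, j) \in s \/ A i j = M i j -> A' i j = M i j).
Proof.
elim: s A => [|e s IH] A /=; first by exists A; split=> // i j [].
have [A' [-> AM]] := IH (\matrix_(i, j) if (i, j) == e then M e.1 e.2 else A i j).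
exists A'; split=> // i j H; apply: AM; rewrite mxE inE in H *.
case: eqP H => [<- _|_ /= [->|->]]; by [right|left|right].
Qed.

Lemma queries_read_all s K A q :
  (forall A', num_queries (K A') <= q)%N -> (num_queries (read_all s K A) <= size s + q)%N.
Proof.
move=> H; elim: s A => [|e s IH] A //=.
by rewrite ltnS; apply/bigmax_leqP => c _; exact: IH.
Qed.

Definition trial (pq : nat * nat) (K : algorithm Sigma m.+1 n.+1) : algorithm Sigma m.+1 n.+1 :=
  draw_from ([ffun=> ord0], [ffun=> ord0])
    (fun zv : {ffun 'I_pq.1 -> 'I_m.+1} * {ffun 'I_pq.2 -> 'I_n.+1} =>
      read_all [seq (x, y) | x <- codom zv.1, y <- codom zv.2]
        (fun A => if `[< witness P A zv.1 zv.2 >] then Answer _ _ _ false else K)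
        (const_mx s0)).

Lemma witness_agree M A p q (z : {ffun 'I_p -> 'I_m.+1}) (v : {ffun 'I_q -> 'I_n.+1}) :
  (forall i j, A (z i) (v j) = M (z i) (v j)) -> `[< witness P A z v >] = `[< witness P M z v >].
Proof.
move=> AM.
have sub k l (a : 'I_k.+1 -> 'I_m.+1) (b : 'I_l.+1 -> 'I_n.+1) :
    (forall i, exists i', z i' = a i) -> (forall j, exists j', v j' = b j) ->
    mxsub a b A = mxsub a b M.
  move=> za vb; apply/matrixP => i j; rewrite !mxE.
  by have [i' <-] := za i; have [j' <-] := vb j.
apply/asboolP/asboolP => -[k [l [a [b [ma mb za vb nP]]]]]; exists k, l, a, b; split=> //.
- by rewrite -(sub _ _ _ _ za vb).
- by rewrite (sub _ _ _ _ za vb).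
Qed.

Definition witness_rate M (pq : nat * nat) : R :=
  #|[set zv : {ffun 'I_pq.1 -> 'I_m.+1} * {ffun 'I_pq.2 -> 'I_n.+1}
     | `[< witness P M zv.1 zv.2 >]]|%:R / (m.+1 ^ pq.1 * n.+1 ^ pq.2)%:R.

Lemma witness_rate01 M pq : 0 <= witness_rate M pq <= 1.
Proof.
rewrite divr_ge0 //= ler_pdivrMr ?ltr0n ?muln_gt0 ?expn_gt0 // mul1r ler_nat.
by apply: leq_trans (max_card _) _; rewrite card_prod !card_ffun !card_ord.
Qed.

Lemma prob_trial M b pq K : prob_answer R M b (trial pq K) =
  witness_rate M pq * (false == b)%:R + (1 - witness_rate M pq) * prob_answer R M b K.
Proof.
rewrite prob_draw_from card_prod !card_ffun !card_ord.
set T := (_ * _)%N; have T0 : T%:R != 0 :> R by rewrite pnatr_eq0 -lt0n muln_gt0 !expn_gt0.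
pose w (zv : {ffun 'I_pq.1 -> 'I_m.+1} * {ffun 'I_pq.2 -> 'I_n.+1}) : bool :=
  `[< witness P M zv.1 zv.2 >].
rewrite (eq_bigr (fun zv => (w zv)%:R * ((false == b)%:R - prob_answer R M b K)
    + prob_answer R M b K)); last first.
  move=> zv _; have [A' [-> AM]] := prob_read_all [seq (x, y) | x <- codom zv.1, y <- codom zv.2]
    (fun A => if `[< witness P A zv.1 zv.2 >] then Answer _ _ _ false else K) M b (const_mx s0).
  rewrite (@witness_agree M A') -/(w zv); last first.
    by move=> i j; apply: AM; left; apply: allpairs_f; exact: codom_f.
  by case: (w zv) => /=; ring.
rewrite big_split /= -mulr_suml sumr_const card_prod !card_ffun !card_ord -/T.
have -> : \sum_zv (w zv)%:R = witness_rate M pq * T%:R.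
  by rewrite /witness_rate mulfVK // -sum1_card natr_sum [RHS]big_mkcond;
    apply: eq_bigr => zv _; rewrite inE /w; case: asboolP.
by rewrite -[_ *+ T]mulr_natl; field.
Qed.

(** The sample size rich in witnesses varies with the input, so every size up to [N] is tried. *)
Definition all_trials (N : nat) : seq (nat * nat) :=
  [seq (p, q) | p <- iota 0 N.+1, q <- iota 0 N.+1].

Definition repeated_trials (N r : nat) : algorithm Sigma m.+1 n.+1 :=
  iter r (fun K => foldr trial K (all_trials N)) (Answer _ _ _ true).

Lemma queries_foldr (N q : nat) (s : seq (nat * nat)) K :
  {in s, forall pq, pq.1 <= N /\ pq.2 <= N}%N -> (num_queries K <= q)%N ->
  (num_queries (foldr trial K s) <= size s * (N * N) + q)%N.
Proof.
move=> H Kq; elim: s H => [|pq s IH] H; first by [].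
have [hp hq] := H pq (mem_head _ _).
have IHs : (num_queries (foldr trial K s) <= size s * (N * N) + q)%N.
  by apply: IH => x xs; apply: H; rewrite inE xs orbT.
apply: (@queries_draw_from _ _ _ (size (pq :: s) * (N * N) + q)%N) => zv; rewrite /= mulSn -addnA.
apply: leq_trans (queries_read_all (q := (size s * (N * N) + q)%N) _ _ _) _.
  by move=> A; case: ifP.
by rewrite size_allpairs !size_codom !card_ord leq_add2r leq_mul.
Qed.

Lemma all_trialsP N pq : reflect (pq.1 <= N /\ pq.2 <= N)%N (pq \in all_trials N).
Proof.
have in_iota k : (k \in iota 0 N.+1) = (k <= N)%N by rewrite mem_iota add0n ltnS.
apply: (iffP allpairsP) => [[x [hp hq ->]]|[hp hq]]; first by rewrite -!in_iota.
by exists pq; rewrite !in_iota; split=> //; case: (pq).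
Qed.

Lemma queries_repeated (N r : nat) :
  (num_queries (repeated_trials N r) <= r * (N.+1 * N.+1 * (N * N)))%N.
Proof.
elim: r => [|r IH] //; rewrite mulSn /repeated_trials iterS.
apply: leq_trans (queries_foldr (N := N) _ IH) _; first by move=> pq /all_trialsP.
by rewrite size_allpairs !size_iota.
Qed.

Lemma reject_repeated M (N r : nat) :
  1 - prob_answer R M false (repeated_trials N r) =
  (\prod_(pq <- all_trials N) (1 - witness_rate M pq)) ^+ r.
Proof.
elim: r => [|r IH]; first by rewrite /= subr0.
rewrite exprS -IH /repeated_trials iterS; move: (iter r _ _) => K.
elim: (all_trials N) => [|pq s IHs]; first by rewrite big_nil mul1r.
rewrite big_cons -mulrA -IHs (_ : foldr _ _ (pq :: s) = trial pq (foldr trial K s)) //.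
by rewrite prob_trial /=; ring.
Qed.

Lemma accept_repeated M (N r : nat) : (forall pq, witness_rate M pq = 0) ->
  prob_answer R M true (repeated_trials N r) = 1.
Proof.
move=> w0; elim: r => [|r] //; rewrite /repeated_trials iterS; move: (iter r _ _) => K IH.
elim: (all_trials N) => [|pq s IHs]; first exact: IH.
rewrite (_ : foldr _ _ (pq :: s) = trial pq (foldr trial K s)) //.
by rewrite prob_trial w0 mul0r add0r subr0 mul1r.
Qed.

(** Each round contains a trial that finds a witness with probability at least [1 / N]. *)
Lemma reject_detected M (N : nat) : detects P N M ->
  2%:R / 3%:R <= prob_answer R M false (repeated_trials N (2 * N)).
Proof.
case=> p [q [pN qN]] large.
have T0 : (0 < m.+1 ^ p * n.+1 ^ q)%N by rewrite muln_gt0 !expn_gt0.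
have N0 : (0 < N)%N by move: (leq_trans T0 large); rewrite muln_gt0 => /andP [].
have N0R : 0 < N%:R :> R by rewrite ltr0n.
pose x : R := N%:R^-1.
have x0 : 0 < x by rewrite invr_gt0.
have x1 : x <= 1 by rewrite invf_le1 // ler1n.
have rate : x <= witness_rate M (p, q).
  rewrite /x ler_pdivlMr ?ltr0n // mulrC ler_pdivrMr // mulrC -natrM ler_nat.
  exact: large.
have fac01 pq : 0 <= 1 - witness_rate M pq <= 1.
  by have /andP [? ?] := witness_rate01 M pq; apply/andP; split; lra.
have prod_le : \prod_(pq <- all_trials N) (1 - witness_rate M pq) <= 1 - x.
  rewrite (perm_big _ (perm_to_rem (_ : (p, q) \in all_trials N))) /=; last exact/all_trialsP.
  rewrite big_cons; apply: (@le_trans _ _ (1 - witness_rate M (p, q))); last by rewrite lerD2l lerN2.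
  have /andP [f0 _] := fac01 (p, q).
  rewrite ler_piMr // prodr_ile1 // => pq _; exact: fac01.
have prod_ge : 0 <= \prod_(pq <- all_trials N) (1 - witness_rate M pq).
  by rewrite prodr_ge0 // => pq _; case/andP: (fac01 pq).
(* By Bernoulli's inequality; [r = 2 * N] and [x = 1 / N] bound the failure probability by
   [1 / 3]. *)
have bern r : (1 - x) ^+ r * (1 + r%:R * x) <= 1.
  elim: r => [|r IH]; first by rewrite expr0 mul0r addr0 mulr1.
  apply: le_trans IH; rewrite exprSr -mulrA ler_wpM2l ?exprn_ge0 ?subr_ge0 // -natr1.
  have : 0 <= r%:R * x * x by rewrite !mulr_ge0 // ltW.
  by nra.
have := bern (2 * N)%N; rewrite natrM -mulrA /x mulfV ?gt_eqF // mulr1 -/x => bound.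
have := reject_repeated M N (2 * N).
have : (\prod_(pq <- all_trials N) (1 - witness_rate M pq)) ^+ (2 * N) <= (1 - x) ^+ (2 * N).
  by rewrite lerXn2r ?nnegrE ?subr_ge0.
by move: bound; lra.
Qed.

End Trials.

Theorem theorem1p7 (R : realType) (Sigma : finType) (hSigma : (2 <= #|Sigma|)%N)
    (P : mxproperty Sigma) (hP : hereditary P) : strongly_testable R P.
Proof.
(* [s0] fills the entries that a trial has not read. *)
have [s0 _] : exists s0 : Sigma, s0 \in Sigma by apply/card_gt0P; exact: ltnW.
have /choice [N HN] : forall eps : R, exists N, 0 < eps ->
    forall (m n : nat) (M : 'M[Sigma]_(m.+1, n.+1)), far P eps M -> detects P N M.
  move=> eps; have [eps0|neps] := boolP (0 < eps); last by exists 0%N.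
  by have [N HN] := detection P eps0; exists N.
exists (fun eps m n => repeated_trials P s0 m n (N eps) (2 * N eps)).
exists (fun eps => 2 * N eps * ((N eps).+1 * (N eps).+1 * (N eps * N eps)))%N.
split=> [eps m n M eps0|eps m n eps0]; last exact: queries_repeated.
split=> [PM|farM]; last exact/reject_detected/HN.
(* A witness is a submatrix outside [P], which heredity excludes, so every rate is zero. *)
apply: accept_repeated => pq; rewrite /witness_rate (_ : [set _ | _] = set0) ?cards0 ?mul0r //.
apply/setP => zv; rewrite !inE; apply/asboolP => -[k [l [a [b [ma mb _ _ []]]]]].
exact: hP PM.
Qed.
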